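(* Let $a(x)\in\mathbf{U}$ satisfy $1\prec a(x)\prec x$, i.e. $\lim_{x\to\infty}|a(x)|=\infty$ and $\lim_{x\to\infty}a(x)/x=0$. Let $W(x)\in\mathbf{E}$ be such that $w(x):=W'(x)$ is positive and non-increasing and $\lim_{x\to\infty}W(x)=\infty$. Suppose that there exists $c>0$ such that for all large enough $x$, $$W(x)\le |a(x)|^{c}.$$ Then the sequence $(\lfloor a(n)\rfloor)_{n\in\mathbb{N}}$ is pointwise $L^1$-good for $W$-averages and ergodic for $W$-averages.
   Context: Let $\mathbf{B}$ be the ring of germs at $+\infty$ of continuous real functions on $\mathbb{R}$. A Hardy field is a subfield of $\mathbf{B}$ closed under differentiation. $\mathbf{U}$ denotes the union of all Hardy fields. A Hardy field is maximal if it is not a proper subfield of a larger Hardy field; $\mathbf{E}$ denotes the intersection of all maximal Hardy fields. Since these are germs, properties such as positivity and monotonicity are understood for all sufficiently large $x$, and finitely many values of $n$ are irrelevant in the limits below. For a sequence $\mathsf{a}=(\lfloor a(n)\rfloor)_{n\in\mathbb{N}}$ and a probability measure preserving system $(X,\mathcal{B},\mu,T)$ put $$\mathbb{A}_N^{\mathsf{a},W}f(x)=\frac{1}{W(N)}\sum_{n=1}^N w(n)\,f(T^{\lfloor a(n)\rfloor}x).$$ The sequence is pointwise $L^p$-good for $W$-averages if for every invertible probability measure preserving system $(X,\mathcal{B},\mu,T)$ and every $f\in L^p(\mu)$, $\mathbb{A}_N^{\mathsf{a},W}f(x)$ converges as $N\to\infty$ for $\mu$-almost every $x$. It is ergodic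 for $W$-averages if for every invertible ergodic probability measure preserving system and every $f\in L^2(\mu)$, $\mathbb{A}_N^{\mathsf{a},W}f\to\int f\,d\mu$ in $L^2(\mu)$. *)

(* Defs.v *)
From HB Require Import structures.
From mathcomp Require Import all_boot all_order all_algebra.
From mathcomp Require Import all_classical all_reals all_analysis.

Set Implicit Arguments.
Unset Strict Implicit.
Unset Printing Implicit Defensive.

Import Order.TTheory GRing.Theory Num.Theory.
Import numFieldNormedType.Exports.

Local Open Scope ring_scope.
Local Open Scope classical_set_scope.

(** Germs at [+oo] are handled through representatives [f : R -> R]: equality
    of germs is [germ_eq], and a set of germs is a set of functions saturated
    for [germ_eq].  [germB] is the full ring of germs of continuous functions:
    a representative may be arbitrary off a neighbourhood of [+oo]. *)

Definition germ_eq (R : realType) (f g : R -> R) : Prop :=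
  \forall x \near +oo, f x = g x.

Definition germB {R : realType} : set (R -> R) :=
  [set f | exists2 g : R -> R, continuous g & germ_eq f g].

(** The germ of [derive1 f] depends only on that of [f].  Since [derive1] is a
    total operator, differentiability near [+oo] is required separately. *)
Record Hardy_field (R : realType) (H : set (R -> R)) : Prop := {
  Hardy_germB : H `<=` germB ;
  Hardy_saturated : forall f g, H f -> germ_eq f g -> H g ;
  Hardy_one : H (cst 1) ;
  Hardy_sub : forall f g, H f -> H g -> H (f \- g) ;
  Hardy_mul : forall f g, H f -> H g -> H (f \* g) ;
  Hardy_inv : forall f, H f -> ~ germ_eq f (cst 0) ->
    exists2 g, H g & germ_eq (f \* g) (cst 1) ;
  Hardy_derivable : forall f, H f -> \forall x \near +oo, derivable f x 1 ;
  Hardy_derive : forall f, H f -> H (derive1 f) }.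

Definition maximal_Hardy_field (R : realType) (H : set (R -> R)) : Prop :=
  Hardy_field H /\ forall K, Hardy_field K -> H `<=` K -> K = H.

Definition Hardy_U {R : realType} : set (R -> R) :=
  [set f | exists2 H, Hardy_field H & H f].

Definition Hardy_E {R : realType} : set (R -> R) :=
  [set f | forall H, maximal_Hardy_field H -> H f].

(** Invertible measure preserving transformation of a probability space, with
    its (measurable) inverse.  The inverse preserves the measure as well, by
    the other fields. *)
Record invertible_mpt (R : realType) (d : measure_display)
    (X : measurableType d) (mu : probability X R) := InvertibleMpt {
  mpt_fun : X -> X ;
  mpt_inv : X -> X ;
  mpt_funK : cancel mpt_fun mpt_inv ;
  mpt_invK : cancel mpt_inv mpt_fun ;
  mpt_measurable_fun : measurable_fun setT mpt_fun ;
  mpt_measurable_inv : measurable_fun setT mpt_inv ;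
  mpt_preserving : forall A : set X, measurable A ->
    mu (mpt_fun @^-1` A) = mu A }.

Definition mpt_iter (R : realType) (d : measure_display)
    (X : measurableType d) (mu : probability X R) (T : invertible_mpt mu)
    (k : int) (x : X) : X :=
  match k with
  | Posz n => iter n (mpt_fun T) x
  | Negz n => iter n.+1 (mpt_inv T) x
  end.

Definition ergodic_mpt (R : realType) (d : measure_display)
    (X : measurableType d) (mu : probability X R) (T : invertible_mpt mu) :
    Prop :=
  forall A : set X, measurable A -> mpt_fun T @^-1` A = A ->
    mu A = 0%E \/ mu A = 1%E.

(** The averages [A_N^{a,W} f] along an integer sequence [s], with weight
    [w = W'].  For [W] tending to [+oo] in a Hardy field, only finitely many
    [N] have [W N = 0] and only finitely many [n] are points where [W] is not
    differentiable; there the default values of [_^-1] and [derive1] are used,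
    which does not affect limits as [N] tends to infinity. *)
Definition W_average (R : realType) (W : R -> R) (s : nat -> int)
    (d : measure_display) (X : measurableType d) (mu : probability X R)
    (T : invertible_mpt mu) (f : X -> R) (N : nat) (x : X) : R :=
  (W N%:R)^-1 * \sum_(1 <= n < N.+1) derive1 W n%:R * f (mpt_iter T (s n) x).

Definition pointwise_good (R : realType) (p : \bar R) (W : R -> R)
    (s : nat -> int) : Prop :=
  forall (d : measure_display) (X : measurableType d) (mu : probability X R)
    (T : invertible_mpt mu) (f : X -> R),
  f \in Lfun mu p ->
  {ae mu, forall x, cvgn (fun N => W_average W s T f N x)}.

Definition ergodic_for_averages (R : realType) (W : R -> R) (s : nat -> int) :
    Prop :=
  forall (d : measure_display) (X : measurableType d) (mu : probability X R)
    (T : invertible_mpt mu) (f : X -> R),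
  ergodic_mpt T -> f \in Lfun mu 2%:E ->
  ('N[mu]_(2%:E)[EFin \o (fun x =>
      W_average W s T f N x - \int[mu]_y f y)%R])%E @[N --> \oo] --> 0%E.

(* Main.v *)
(** The sequence of values of [floor (a n)] runs through consecutive integers,
    so everything is a comparison of weighted means with ordinary Cesaro means
    along the orbits of [T] or of its inverse, where Birkhoff's theorem (proved
    through Garsia's maximal inequality) applies.

    Put [b = `|a|] and work in a Hardy field containing both [a] and [W].  There
    [b' > 0] decreases to [0], so [sum_n (b (n+1) - b n) F (floor (b n))] is a
    Riemann sum for the step function [F (floor t)] whose errors are located at
    the jumps of the floor, and the means with weights [b (n+1) - b n] converge
    to the Cesaro limit of [F].  Moreover [b' (n) ~ b (n+1) - b n], and
    [W' = u b'] with [u] eventually monotone.  The hypothesis [W <= b ^ c]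
    forces [W' b <= C W b'], i.e. [u b <= C W], and this is exactly what makes
    Abel summation transfer the convergence to the weights [W'].

    The convergence in [L^2] follows from pointwise convergence for [f] and
    [f ^ 2] by a dominated convergence argument. *)
Require Import Defs.
From HB Require Import structures.
From mathcomp Require Import all_boot all_order all_algebra.
From mathcomp Require Import all_classical all_reals all_analysis.
From mathcomp Require Import measurable_realfun ring lra.
Set Implicit Arguments.
Unset Strict Implicit.
Unset Printing Implicit Defensive.

Import Order.TTheory GRing.Theory Num.Theory.
Import numFieldNormedType.Exports.
Local Open Scope ring_scope.
Local Open Scope classical_set_scope.

(** * Birkhoff's theorem *)

(** Hardy fields enter mostly through one consequence of invertibility: each element is eventually
    zero, positive or negative. An inequality between germs is therefore proved by refuting its
    strict opposite, which would make an auxiliary function eventually monotone, against its known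
    growth. The germ [a] is only known to lie in some Hardy field while [W] lies in every maximal
    one, so extending the field of [a] to a maximal one by Zorn's lemma places both in the same
    field.

    The function [f] is merely integrable, so its values along an orbit need not be bounded and
    errors cannot be estimated in the supremum norm. The comparisons of means therefore also use the
    Cesaro means of [|F|], whose convergence is Birkhoff's theorem for [|f|]: an error is a small
    coefficient against a bounded mean of [|F|].

    If [a] is negative, [floor (a n)] is [- (m + 1)] with [m < b n <= m + 1]. The comparison is then
    with the backward orbit started at the preimage of [x], and the bounds on integer parts are kept
    closed at both ends to cover both signs. *)

Section measure_preserving.
Context {R : realType} {d : measure_display} {X : measurableType d}.
Variables (mu : probability X R) (T : X -> X).
Hypothesis mT : measurable_fun setT T.
Hypothesis muT : forall A, measurable A -> mu (T @^-1` A) = mu A.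

Lemma ge0_integral_mpt (f : X -> \bar R) : measurable_fun setT f ->
  (forall x, 0 <= f x)%E -> (\int[mu]_x f (T x) = \int[mu]_x f x)%E.
Proof.
move=> mf f0; have /= <-// := ge0_integral_pushforward mT mu measurableT mf.
by apply: eq_measure_integral => A mA _; exact: muT.
Qed.

Lemma integrable_mpt (f : X -> R) :
  mu.-integrable setT (EFin \o f) -> mu.-integrable setT (EFin \o (f \o T)).
Proof.
move=> /integrableP[mf fi]; apply/integrableP; split.
  exact: (measurableT_comp mf mT).
by rewrite (@ge0_integral_mpt (fun x => `|(f x)%:E|%E))//; exact: measurableT_comp.
Qed.

Lemma Rintegral_mpt (f : X -> R) : mu.-integrable setT (EFin \o f) ->
  \int[mu]_x f (T x) = \int[mu]_x f x.
Proof.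
move=> fi; rewrite /Rintegral; congr fine.
have mf : measurable_fun setT (EFin \o f) by exact: measurable_int fi.
have /= <-// := integral_pushforward mT mf (integrable_mpt fi) measurableT.
by apply: eq_measure_integral => A mA _; exact: muT.
Qed.

Lemma measurable_mpt_iter n : measurable_fun setT (iter n T).
Proof.
by elim: n => [|n IH]; [exact: measurable_id|exact: (measurableT_comp mT IH)].
Qed.

Lemma integrable_mpt_iter n (f : X -> R) :
  mu.-integrable setT (EFin \o f) ->
  mu.-integrable setT (EFin \o (fun x => f (iter n T x))).
Proof.
move=> fi; elim: n => [//|n IH].
by under eq_fun => x do rewrite iterSr; exact: (integrable_mpt IH).
Qed.

Lemma Rintegral_mpt_iter n (f : X -> R) : mu.-integrable setT (EFin \o f) ->
  \int[mu]_x f (iter n T x) = \int[mu]_x f x.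
Proof.
move=> fi; elim: n => [//|n IH]; rewrite -IH.
under eq_Rintegral do rewrite iterSr.
by rewrite (@Rintegral_mpt (fun x => f (iter n T x)))//; exact: integrable_mpt_iter.
Qed.

Lemma integrable_mul_indic (g : X -> R) (A : set X) : measurable A ->
  mu.-integrable setT (EFin \o g) ->
  mu.-integrable setT (EFin \o (fun x => g x * \1_A x)).
Proof.
move=> mA gi.
have -> : EFin \o (fun x => g x * \1_A x) = ((EFin \o g) \* (EFin \o \1_A))%E by [].
apply: integrableMl => //; exists 1; split => // M M1 x _ /=.
by rewrite (le_trans _ (ltW M1))// ger0_norm ?indic_le1.
Qed.

Lemma Rintegral_mul_indic (g : X -> R) (A : set X) :
  \int[mu]_x (g x * \1_A x) = \int[mu]_(x in A) g x.
Proof. by rewrite [RHS]Rintegral_mkcond patch_indic. Qed.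

(** Unfolded, this is the maximum over [j <= n] of the Birkhoff sums of [g] of length [j]; in
    recursive form, Garsia's relation with the value at [T x] holds by computation. *)
Fixpoint ergodic_max (g : X -> R) (n : nat) (x : X) : R :=
  if n is m.+1 then Num.max 0 (g x + ergodic_max g m (T x)) else 0.

Lemma ergodic_max_ge0 g n x : 0 <= ergodic_max g n x.
Proof. by case: n => //= n; rewrite le_max lexx. Qed.

Lemma ergodic_max_le g n x : ergodic_max g n x <= ergodic_max g n.+1 x.
Proof.
elim: n x => [|n IH] x; first exact: ergodic_max_ge0.
rewrite /= ge_max le_max lexx/= le_max; apply/orP; right.
by rewrite lerD2l; exact: IH.
Qed.

Lemma ergodic_max_homo g x :
  {homo (fun n => ergodic_max g n x) : m n / (m <= n)%N >-> m <= n}.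
Proof. by apply: homo_leq => //; [exact: le_trans|move=> n; exact: ergodic_max_le]. Qed.

Lemma birkhoff_sum_le_ergodic_max g n x :
  \sum_(0 <= i < n) g (iter i T x) <= ergodic_max g n x.
Proof.
elim: n x => [|n IH] x; first by rewrite big_geq.
rewrite big_nat_recl//= le_max; apply/orP; right; rewrite lerD2l.
under eq_bigr do rewrite -iterS iterSr.
exact: IH.
Qed.

Lemma integrable_ergodic_max g n : mu.-integrable setT (EFin \o g) ->
  mu.-integrable setT (EFin \o ergodic_max g n).
Proof.
move=> gi; elim: n => [|n IH]; first exact: finite_measure_integrable_cst.
have hi : mu.-integrable setT (EFin \o (fun x => g x + ergodic_max g n (T x))).
  have -> : EFin \o (fun x => g x + ergodic_max g n (T x)) =
      ((EFin \o g) \+ (EFin \o (ergodic_max g n \o T)))%E by [].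
  by apply: integrableD => //; exact: integrable_mpt.
apply: (le_integrable _ _ _ hi) => //.
  apply/measurable_EFinP; apply: measurable_maxr => //.
  by apply/measurable_EFinP; exact: measurable_int hi.
move=> x _ /=; rewrite lee_fin ger0_norm ?le_max ?lexx//.
by rewrite ge_max normr_ge0 ler_norm.
Qed.

Lemma measurable_ergodic_max_gt0 g n : mu.-integrable setT (EFin \o g) ->
  measurable [set x | 0 < ergodic_max g n x].
Proof.
move=> gi; have mm : measurable_fun setT (ergodic_max g n).
  apply/measurable_EFinP.
  by have /measurable_int := integrable_ergodic_max n gi; exact.
rewrite [X in measurable X](_ : _ = ergodic_max g n @^-1` `]0, +oo[%classic).
  by rewrite -[X in measurable X]setTI; exact: mm.
by apply/seteqP; split=> x /=; rewrite in_itv/= andbT.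
Qed.

(* Garsia: on the set where the maximum is positive it equals
   [g + max g n \o T], so that it exceeds its composition with [T] by at most
   [g]. *)
Lemma maximal_ergodic (g : X -> R) n : mu.-integrable setT (EFin \o g) ->
  0 <= \int[mu]_x (g x * \1_[set y | 0 < ergodic_max g n.+1 y] x).
Proof.
move=> gi; set m := ergodic_max g n.+1; set A := [set y | 0 < m y].
have mi : mu.-integrable setT (EFin \o m) by exact: integrable_ergodic_max.
have mA : measurable A by exact: measurable_ergodic_max_gt0.
have -> : 0 = \int[mu]_x (m x - m (T x)).
  rewrite RintegralB//; last exact: integrable_mpt.
  by rewrite Rintegral_mpt// subrr.
apply: le_Rintegral => //.
- have -> : EFin \o (fun x => m x - m (T x)) =
      ((EFin \o m) \- (EFin \o (m \o T)))%E by [].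
  by apply: integrableB => //; exact: integrable_mpt.
- exact: integrable_mul_indic.
- move=> x _; rewrite indicE; have [xA|xA] := boolP (x \in A).
    rewrite mulr1 lerBlDr; move: xA; rewrite inE /A /= /m /= lt_max ltxx/= => h.
    rewrite (max_idPr (ltW h)) lerD2l.
    exact: ergodic_max_le.
  rewrite mulr0 subr_le0 (le_trans _ (ergodic_max_ge0 _ _ _))//.
  by move: xA; rewrite notin_setE /A /= => /negP; rewrite -leNgt.
Qed.

(** The maximal inequality is applied to [g = (f - q) * \1_A]. By invariance, the sums of [g] along
    an orbit inside [A] are those of [f - q], one of which is positive; so each point of [A]
    eventually belongs to the set where the maximum is positive, and dominated convergence leaves
    the integral of [f - q] over [A]. *)
Lemma maximal_ergodic_invariant (f : X -> R) (A : set X) (q : R) :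
  mu.-integrable setT (EFin \o f) -> measurable A -> T @^-1` A = A ->
  (forall x, A x -> exists n, q *+ n < \sum_(0 <= i < n) f (iter i T x)) ->
  q * fine (mu A) <= \int[mu]_(x in A) f x.
Proof.
move=> fi mA TA qA; pose g x := (f x - q) * \1_A x.
have TAi i x : A (iter i T x) = A x.
  by elim: i => //= i <-; rewrite -[in RHS]TA.
have fqi : mu.-integrable setT (EFin \o (fun x => f x - q)).
  have -> : EFin \o (fun x => f x - q) = ((EFin \o f) \- (EFin \o cst q))%E by [].
  by apply: integrableB => //; exact: finite_measure_integrable_cst.
have gi : mu.-integrable setT (EFin \o g).
  exact: integrable_mul_indic.
pose h n x := g x * \1_[set y | 0 < ergodic_max g n.+1 y] x.
have gh x : h n x @[n --> \oo] --> g x.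
  have [xA|xA] := pselect (A x); last first.
    have g0 : g x = 0 by rewrite /g indicE memNset// mulr0.
    by rewrite (_ : h^~ x = cst 0) ?g0; [exact: cvg_cst|
      apply/funext => n; rewrite /h g0 mul0r].
  have [n qn] := qA x xA.
  apply: cvg_near_cst; exists n => // k /= nk.
  rewrite /h indicE mem_set ?mulr1//=.
  have /lt_le_trans : 0 < \sum_(0 <= i < n) g (iter i T x).
    rewrite /g; under eq_bigr => i _.
      rewrite indicE mem_set ?mulr1 ?TAi//.
      over.
    by rewrite sumrB sumr_const_nat subn0 subr_gt0.
  apply; apply: le_trans (birkhoff_sum_le_ergodic_max _ _ _) _.
  exact: (ergodic_max_homo g x (leqW nk)).
have hi n : mu.-integrable setT (EFin \o h n).
  by apply: integrable_mul_indic => //; exact: measurable_ergodic_max_gt0.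
have hcvg : (\int[mu]_x (h n x)%:E)%E @[n --> \oo] --> (\int[mu]_x (g x)%:E)%E.
  have [] // := @dominated_convergence _ _ _ mu setT measurableT
    (fun n => EFin \o h n) (EFin \o g) (fun x => `|(g x)%:E|%E).
  - by move=> n; exact: measurable_int (hi n).
  - exact: measurable_int gi.
  - apply: aeW => x _; exact: (cvg_comp _ _ (gh x)).
  - exact: integrable_abse.
  - apply: aeW => x n _; rewrite /= lee_fin /h normrM ler_piMr//.
    by rewrite ger0_norm// indic_le1.
have g0 : 0 <= \int[mu]_x g x.
  rewrite /Rintegral fine_ge0//; apply: cvge_ge hcvg; apply: nearW => n.
  rewrite -(fineK (integrable_fin_num _ (hi n)))// lee_fin.
  exact: maximal_ergodic.
move: g0; rewrite Rintegral_mul_indic RintegralB//.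
- by rewrite Rintegral_cst// subr_ge0.
- exact: integrableS fi.
- by apply: finite_measure_integrable_cst.
Qed.
End measure_preserving.

(** * Upper limits in the extended reals *)

Section ereal_lemmas.
Context {R : realType}.
Local Open Scope ereal_scope.

Lemma rat_between (a b : \bar R) : a < b ->
  exists q : rat, a < (ratr q)%:E /\ (ratr q)%:E < b.
Proof.
move=> ab; have [r [s [rs ar sb]]] : exists r s : R, [/\ (r < s)%R, a <= r%:E & s%:E <= b].
  move: a b ab => [a| |] [b| |]//.
  - by rewrite lte_fin => ab; exists a, b.
  - by move=> _; exists a, (a + 1)%R; rewrite ltrDl leey.
  - by move=> _; exists (b - 1)%R, b; rewrite ltrBlDr ltrDl leNye.
  - by move=> _; exists 0%R, 1%R; rewrite leNye leey.
have /rat_in_itvoo[q] := rs; rewrite in_itv/= => /andP[rq qs].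
exists q; split; first by rewrite (le_lt_trans ar)// lte_fin.
by rewrite (lt_le_trans _ sb)// lte_fin.
Qed.

Lemma lt_limn_esup (u : (\bar R)^nat) (a : \bar R) : a < limn_esup u ->
  forall N, exists2 n, (N <= n)%N & a < u n.
Proof.
move=> + N; rewrite limn_esup_lim => au.
have : limn (esups u) <= esups u N.
  apply: lime_le; first exact: is_cvg_esups.
  by exists N => // n /= Nn; exact: nonincreasing_esups.
move=> /(lt_le_trans au) /ereal_sup_gt[_ [n /= Nn <-] h].
by exists n.
Qed.

Lemma limn_esup_ge (u : (\bar R)^nat) (a : \bar R) :
  (forall N, exists2 n, (N <= n)%N & a <= u n) -> a <= limn_esup u.
Proof.
move=> au; rewrite limn_esup_lim; apply: lime_ge; first exact: is_cvg_esups.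
apply: nearW => N; have [n Nn /le_trans] := au N; apply.
by apply: ereal_sup_ubound; exists n.
Qed.

(** The room between [p] and [q] is what absorbs vanishing errors when the averages at [x] and at
    [T x] are compared. *)
Lemma le_limn_esup_freq (u v : (\bar R)^nat) :
  (forall p q : R, (p < q)%R -> (forall N, exists2 n, (N <= n)%N & q%:E < u n) ->
     forall N, exists2 n, (N <= n)%N & p%:E <= v n) ->
  limn_esup u <= limn_esup v.
Proof.
move=> uv; rewrite leNgt; apply/negP => /rat_between[p [vp pu]].
have [q [pq qu]] := rat_between pu.
suff : (ratr p)%:E <= limn_esup v by rewrite leNgt vp.
apply: limn_esup_ge; apply: (uv _ (ratr q)); first by rewrite -lte_fin.
exact: lt_limn_esup.
Qed.

Lemma limn_esup_cvg (u : (\bar R)^nat) (l : \bar R) :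
  limn_esup u <= l -> limn_esup (\- u) <= - l -> u @ \oo --> l.
Proof.
move=> ul Nul.
have lu : l <= limn_einf u by rewrite /limn_einf leeNr.
have uE : limn_esup u = l.
  by apply/eqP; rewrite eq_le ul (le_trans lu)// limn_einf_sup.
have uE' : limn_einf u = l.
  by apply/eqP; rewrite eq_le lu -[leRHS]uE limn_einf_sup.
apply: (@squeeze_cvge _ _ _ _ (einfs u) _ (esups u)).
- by apply: nearW => n; rewrite ereal_inf_lbound ?ereal_sup_ubound//; exists n => /=.
- by rewrite -uE' limn_einf_lim; exact: is_cvg_einfs.
- by rewrite -uE limn_esup_lim; exact: is_cvg_esups.
Qed.

End ereal_lemmas.

(** * Almost everywhere convergence of Birkhoff averages *)

Section birkhoff.
Context {R : realType} {d : measure_display} {X : measurableType d}.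
Variables (mu : probability X R) (T : X -> X).
Hypothesis mT : measurable_fun setT T.
Hypothesis muT : forall A, measurable A -> mu (T @^-1` A) = mu A.

Definition birkhoff_sup (f : X -> R) (x : X) : \bar R :=
  limn_esup (fun n => ((\sum_(0 <= i < n) f (iter i T x)) / n%:R)%:E).

Lemma measurable_birkhoff_sup f : measurable_fun setT f ->
  measurable_fun setT (birkhoff_sup f).
Proof.
move=> mf; apply: measurable_fun_limn_esup => n.
apply/measurable_EFinP; apply: measurable_funM => //.
apply: measurable_sum => i; apply: measurableT_comp => //.
exact: measurable_mpt_iter.
Qed.

Lemma birkhoff_supT f x : birkhoff_sup f (T x) = birkhoff_sup f x.
Proof.
(* Moving the base point changes a sum by one term and its length by one; for large [n] the gap
   [(q - p) n] outweighs this constant. *)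
have big_lt (C p q : R) : p < q ->
    exists N, forall n, (N <= n)%N -> p *+ n + C <= q *+ n.
  move=> pq; exists (Num.truncn (C / (q - p))).+1 => n Nn.
  have : C / (q - p) <= n%:R by rewrite ltW// (lt_le_trans (truncnS_gt _))// ler_nat.
  by rewrite ler_pdivrMr ?subr_gt0// mulrBr !mulr_natl lerBrDl.
apply/eqP; rewrite eq_le; apply/andP; split;
    apply: le_limn_esup_freq => p q pq qu N.
- have [M hM] := big_lt (p - f x) _ _ pq.
  have [n] := qu (maxn 1 (maxn M N)).
  rewrite !geq_max => /and3P[n0 Mn Nn].
  rewrite lte_fin ltr_pdivlMr ?ltr0n// => h.
  exists n.+1; first exact: leqW.
  rewrite lee_fin ler_pdivlMr// big_nat_recl//=.
  under eq_bigr do rewrite -iterS iterSr.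
  have := hM _ Mn; move: h; rewrite mulr_natr mulr_natr mulrSr; lra.
- have [M hM] := big_lt (f x - q) _ _ pq.
  have [n] := qu (maxn 2 (maxn M.+1 N.+1)).
  rewrite !geq_max; case: n => // n /and3P[n0 Mn Nn].
  rewrite lte_fin ltr_pdivlMr// big_nat_recl//=.
  under eq_bigr do rewrite -iterS iterSr.
  move=> h; exists n => //; rewrite lee_fin ler_pdivlMr ?ltr0n//.
  have := hM _ Mn; move: h; rewrite mulr_natr mulr_natr mulrSr; lra.
Qed.

Lemma birkhoff_sup_ge_Rintegral (f : X -> R) (A : set X) (q : R) :
  mu.-integrable setT (EFin \o f) -> measurable A -> T @^-1` A = A ->
  (forall x, A x -> (q%:E < birkhoff_sup f x)%E) ->
  q * fine (mu A) <= \int[mu]_(x in A) f x.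
Proof.
move=> fi mA TA qA; apply: (maximal_ergodic_invariant mT muT) => // x /qA.
move=> /lt_limn_esup/(_ 1)[n n0]; rewrite lte_fin ltr_pdivlMr ?ltr0n// => h.
by exists n; rewrite -mulr_natr.
Qed.

(** Minus this quantity is the lower limit of the averages of [f], which thus comes under the
    maximal inequality, applied to [- f]. *)
Lemma birkhoff_supN f x : (birkhoff_sup (\- f)%R x =
  limn_esup (\- (fun n => ((\sum_(0 <= i < n) f (iter i T x)) / n%:R)%R%:E)))%E.
Proof.
congr limn_esup; apply/funext => n.
by rewrite -EFinN; congr EFin; rewrite sumrN mulNr.
Qed.

(** The set where the upper limit is infinite is invariant, and there every [q] is exceeded:
    [q * mu A] stays below a fixed integral for all [q], so [mu A = 0]. *)
Lemma birkhoff_sup_ltoo f : mu.-integrable setT (EFin \o f) ->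
  {ae mu, forall x, birkhoff_sup f x < +oo}%E.
Proof.
move=> fi; have mf : measurable_fun setT f.
  by apply/measurable_EFinP; exact: measurable_int fi.
pose A := [set x | birkhoff_sup f x = +oo%E].
have mA : measurable A.
  have -> : A = birkhoff_sup f @^-1` [set +oo%E] by [].
  by rewrite -[X in measurable X]setTI; exact: measurable_birkhoff_sup.
exists A; split => //; last by move=> x /=; rewrite ltey => /negP; rewrite negbK => /eqP.
have TA : T @^-1` A = A by apply/seteqP; split=> x /=; rewrite /A/= birkhoff_supT.
have h q : q * fine (mu A) <= \int[mu]_(x in A) f x.
  by apply: birkhoff_sup_ge_Rintegral => // x ->; rewrite ltry.
have : 0 <= fine (mu A) by rewrite fine_ge0.
rewrite le_eqVlt => /predU1P[/esym/eqP|A0].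
  by rewrite fine_eq0 ?fin_num_measure// => /eqP.
have := h ((\int[mu]_(x in A) f x + 1) / fine (mu A)).
by rewrite divfK ?gt_eqF// gerDl ler10.
Qed.

Lemma ae_forall_countable (C : countType) (P : C -> X -> Prop) :
  (forall c, {ae mu, forall x, P c x}) -> {ae mu, forall x c, P c x}.
Proof.
move=> aeP; pose Q n x := if unpickle n is Some c then P c x else True.
have /ae_foralln : forall n, \forall x \ae mu, Q n x.
  by move=> n; rewrite /Q; case: unpickle => [c|]; [exact: aeP|exact: aeW].
by apply: filterS => x Qx c; have := Qx (pickle c); rewrite /Q pickleK.
Qed.

(** The set [A] where the lower limit is below [p] and the upper limit above [q] is invariant; the
    maximal inequality for [f] and for [- f] gives [q * mu A <= p * mu A]. *)
Lemma birkhoff_sup_gap f (p q : R) : mu.-integrable setT (EFin \o f) -> p < q ->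
  {ae mu, forall x, ~ (q%:E < birkhoff_sup f x /\
                      (- p)%:E < birkhoff_sup (\- f)%R x)%E}.
Proof.
move=> fi pq; have mf : measurable_fun setT f.
  by apply/measurable_EFinP; exact: measurable_int fi.
have Nfi : mu.-integrable setT (EFin \o (\- f)) by exact: (integrableN fi).
have mNf : measurable_fun setT (\- f) by exact: measurableT_comp.
pose A := [set x | q%:E < birkhoff_sup f x /\
                    (- p)%:E < birkhoff_sup (\- f)%R x]%E.
have mA : measurable A.
  have -> : A = birkhoff_sup f @^-1` `]q%:E, +oo[%classic `&`
                birkhoff_sup (\- f)%R @^-1` `](- p)%:E, +oo[%classic.
    by apply/seteqP; split=> x; rewrite /A/= !in_itv/= !andbT.
  by apply: measurableI; rewrite -[X in measurable X]setTI;
    apply: measurable_birkhoff_sup => //; exact: emeasurable_itv.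
have TA : T @^-1` A = A by apply/seteqP; split=> x; rewrite /A/= !birkhoff_supT.
exists A; split => //; last by move=> x /= /contrapT.
have h1 : q * fine (mu A) <= \int[mu]_(x in A) f x.
  by apply: birkhoff_sup_ge_Rintegral => // x [].
have h2 : - p * fine (mu A) <= \int[mu]_(x in A) (- f x).
  by apply: birkhoff_sup_ge_Rintegral => // x [].
have NfE : \int[mu]_(x in A) (- f x) = - \int[mu]_(x in A) f x.
  under eq_Rintegral do rewrite -mulN1r.
  by rewrite RintegralZl ?mulN1r//; exact: integrableS fi.
have A0 : fine (mu A) = 0.
  apply/eqP; rewrite eq_le fine_ge0// andbT.
  have : (q - p) * fine (mu A) <= 0 by move: h1 h2; rewrite NfE; lra.
  by rewrite pmulr_rle0 ?subr_gt0.
by apply/eqP; rewrite -fine_eq0 ?fin_num_measure// A0.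
Qed.

Lemma birkhoff_cvg_ae f : mu.-integrable setT (EFin \o f) ->
  {ae mu, forall x, cvgn (fun n => (\sum_(0 <= i < n) f (iter i T x)) / n%:R)}.
Proof.
move=> fi; have mf : measurable_fun setT f.
  by apply/measurable_EFinP; exact: measurable_int fi.
have Nfi : mu.-integrable setT (EFin \o (\- f)) by exact: (integrableN fi).
(* Rational thresholds leave only countably many null sets to discard. *)
have gap : {ae mu, forall x (c : rat * rat), ratr c.1 < ratr c.2 :> R ->
    ~ ((ratr c.2)%:E < birkhoff_sup f x /\
       (- ratr c.1)%:E < birkhoff_sup (\- f)%R x)%E}.
  apply: ae_forall_countable => -[p q] /=.
  have [pq|pq] := ltP (ratr p : R) (ratr q); last exact: aeW.
  by have := birkhoff_sup_gap fi pq; apply: filterS => x h _.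
move: gap (birkhoff_sup_ltoo fi) (birkhoff_sup_ltoo Nfi).
apply: filterS3 => x gap au bu.
set u := fun n => (\sum_(0 <= i < n) f (iter i T x)) / n%:R.
have uN : (limn_einf (EFin \o u) = - birkhoff_sup (\- f)%R x)%E.
  by rewrite birkhoff_supN.
have le_au : (birkhoff_sup f x <= - birkhoff_sup (\- f)%R x)%E.
  rewrite leNgt; apply/negP => /rat_between[p [ap /rat_between[q [pq qb]]]].
  apply: (gap (p, q)); first by rewrite -lte_fin.
  by split => //; rewrite EFinN lteNl.
have a_fin : birkhoff_sup f x \is a fin_num.
  rewrite fin_numE -ltey au andbT -ltNye (lt_le_trans _ (limn_einf_sup _))//.
  by rewrite uN lteNr.
have /fine_cvg ul : EFin \o u @ \oo --> (fine (birkhoff_sup f x))%:E.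
  by rewrite fineK//; apply: limn_esup_cvg => //; rewrite -birkhoff_supN leeNr.
by apply/cvg_ex; eexists; exact: ul.
Qed.

(** For [q] above the integral, the set where the upper limit exceeds [q] is invariant, hence null
    or of full measure; full measure would give [q <= \int f]. *)
Lemma birkhoff_sup_ergodic f : mu.-integrable setT (EFin \o f) ->
  (forall A, measurable A -> T @^-1` A = A -> mu A = 0%E \/ mu A = 1%E) ->
  {ae mu, forall x, (birkhoff_sup f x <= (\int[mu]_x f x)%:E)%E}.
Proof.
move=> fi erg; have mf : measurable_fun setT f.
  by apply/measurable_EFinP; exact: measurable_int fi.
set I := \int[mu]_x f x.
have above (q : rat) : I < ratr q ->
    {ae mu, forall x, (birkhoff_sup f x <= (ratr q)%:E)%E}.
  move=> Iq; pose A := [set x | (ratr q)%:E < birkhoff_sup f x]%E.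
  have mA : measurable A.
    have -> : A = birkhoff_sup f @^-1` `](ratr q)%:E, +oo[%classic.
      by apply/seteqP; split=> x; rewrite /A/= in_itv/= andbT.
    rewrite -[X in measurable X]setTI.
    by apply: measurable_birkhoff_sup => //; exact: emeasurable_itv.
  have TA : T @^-1` A = A by apply/seteqP; split=> x; rewrite /A/= birkhoff_supT.
  exists A; split => //; last by move=> x /= /negP; rewrite -ltNge.
  have [//|A1] := erg A mA TA.
  have : ratr q * fine (mu A) <= \int[mu]_(x in A) f x.
    by apply: birkhoff_sup_ge_Rintegral.
  suff -> : \int[mu]_(x in A) f x = I by rewrite A1 mulr1 leNgt Iq.
  rewrite /I /Rintegral (@negligible_integral _ _ _ _ setT (~` A))//.
  - by rewrite setTD setCK.
  - exact: measurableC.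
  - by have := probability_setC mu mA; rewrite A1 subee// => ->.
have : {ae mu, forall x (q : rat), I < ratr q -> (birkhoff_sup f x <= (ratr q)%:E)%E}.
  apply: ae_forall_countable => q.
  have [Iq|] := ltP I (ratr q); last by move=> _; exact: aeW.
  by have := above q Iq; apply: filterS => x h _.
apply: filterS => x h; rewrite leNgt; apply/negP => /rat_between[q [Iq]].
by rewrite ltNge h// -lte_fin.
Qed.

Lemma birkhoff_cvg_ergodic f : mu.-integrable setT (EFin \o f) ->
  (forall A, measurable A -> T @^-1` A = A -> mu A = 0%E \/ mu A = 1%E) ->
  {ae mu, forall x,
    (\sum_(0 <= i < n) f (iter i T x)) / n%:R @[n --> \oo] --> \int[mu]_x f x}.
Proof.
move=> fi erg; have Nfi : mu.-integrable setT (EFin \o (\- f)) by exact: (integrableN fi).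
have := birkhoff_sup_ergodic Nfi erg; have := birkhoff_sup_ergodic fi erg.
apply: filterS2 => x h1.
have -> : \int[mu]_x (\- f) x = - \int[mu]_x f x.
  under eq_Rintegral do rewrite /= -mulN1r.
  by rewrite RintegralZl ?mulN1r.
rewrite birkhoff_supN EFinN => h2.
by have /fine_cvg := limn_esup_cvg h1 h2.
Qed.

End birkhoff.

(** * Integrals and norms *)

Lemma lt_limn_einf {R : realType} (u : (\bar R)^nat) (a : \bar R) :
  (a < limn_einf u)%E -> \forall n \near \oo, (a < u n)%E.
Proof.
move=> au; apply: contrapT => h.
suff : (- a <= limn_esup (\- u))%E by rewrite leNgt -lteNr => /negP; apply.
apply: limn_esup_ge => N; apply: contrapT => hN; apply: h.
exists N => // n /= Nn; rewrite ltNge; apply/negP => una; apply: hN.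
by exists n => //; rewrite leeN2.
Qed.

Section generalized_dominated_convergence.
Context {R : realType} {d : measure_display} {X : measurableType d}.
Variables (mu : probability X R).

(* Fatou's lemma applied to [g n - h n]. *)
Lemma cvg_Rintegral_dominated_cvg (h g : nat -> X -> R) (G : R) :
  (forall n, mu.-integrable setT (EFin \o h n)) ->
  (forall n, mu.-integrable setT (EFin \o g n)) ->
  (forall n x, 0 <= h n x) -> (forall n x, h n x <= g n x) ->
  {ae mu, forall x, h n x @[n --> \oo] --> 0} ->
  {ae mu, forall x, g n x @[n --> \oo] --> G} ->
  \int[mu]_x g n x @[n --> \oo] --> G ->
  \int[mu]_x h n x @[n --> \oo] --> 0.
Proof.
move=> hi gi h0 hg haecvg gaecvg gG.
pose phi n x := g n x - h n x.
have phii n : mu.-integrable setT (EFin \o phi n).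
  have -> : EFin \o phi n = ((EFin \o g n) \- (EFin \o h n))%E by [].
  exact: integrableB.
have phi0 n x : 0 <= phi n x by rewrite subr_ge0.
have mphi n : measurable_fun setT (EFin \o phi n) by exact: measurable_int (phii n).
have := @fatou _ _ _ mu setT measurableT (fun n => EFin \o phi n) mphi
  (fun n x _ => phi0 n x).
have -> : (\int[mu]_x limn_einf (fun n => (EFin \o phi n) x) = G%:E)%E.
  rewrite (ae_eq_integral (cst G%:E))//.
  - by rewrite integral_cst// [X in (_ * X)%E](_ : _ = 1%E) ?mule1//; exact: probability_setT.
  - have m : measurable_fun setT (fun x => limn_esup (fun n => - (phi n x)%:E)%E).
      by apply: measurable_fun_limn_esup => n; exact: (measurableT_comp _ (mphi n)).
    exact: (measurableT_comp _ m).
  - move: haecvg gaecvg; apply: filterS2 => x hx gx _ /=.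
    have phix : phi n x @[n --> \oo] --> G.
      by have := cvgB gx hx; rewrite subr0; exact.
    have phixE : (phi n x)%:E @[n --> \oo] --> G%:E by exact: (cvg_comp _ _ phix).
    by rewrite is_cvg_limn_einfE; [apply/cvg_lim|apply/cvg_ex; exists G%:E].
(* Eventually the integral of [g n] is below [G + e / 2] and, by Fatou, that of [g n - h n] is above
   [G - e / 2]; the difference bounds the integral of [h n] by [e]. *)
move=> fat; apply/cvgr0Pnorm_le => e e0.
have e20 : 0 < e / 2 by rewrite divr_gt0.
have lt1 : ((G - e / 2)%:E < limn_einf (fun n => \int[mu]_x (EFin \o phi n) x))%E.
  by apply: lt_le_trans fat; rewrite lte_fin ltrBlDr ltrDl.
have /cvgrPdist_lt/(_ _ e20) := gG.
move: (lt_limn_einf lt1); apply: filterS2 => n.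
rewrite -(fineK (integrable_fin_num _ (phii n)))// lte_fin.
rewrite (_ : fine _ = \int[mu]_x g n x - \int[mu]_x h n x); last exact: RintegralB.
have : 0 <= \int[mu]_x h n x by exact: Rintegral_ge0.
by move=> hn0; rewrite (ger0_norm hn0) ltr_norml => h1 /andP[h2 h3]; lra.
Qed.

End generalized_dominated_convergence.

(** Absolute values of the weights are taken because [derive1 W n] may be negative for finitely many
    [n]. *)
Lemma weighted_cauchy_schwarz {R : realDomainType} (I : Type) (r : seq I) (v f : I -> R) :
  (\sum_(i <- r) v i * f i) ^+ 2 <=
  (\sum_(i <- r) `|v i|) * \sum_(i <- r) `|v i| * f i ^+ 2.
Proof.
elim: r => [|i r IH]; first by rewrite !big_nil mulr0 expr0n.
rewrite !big_cons /=; set x := \sum_(j <- r) v j * f j in IH *.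
set p := \sum_(j <- r) `|v j| in IH *.
set y := \sum_(j <- r) `|v j| * f j ^+ 2 in IH *.
have p0 : 0 <= p by apply: sumr_ge0.
have y0 : 0 <= y by apply: sumr_ge0 => j _; rewrite mulr_ge0// sqr_ge0.
have py0 : 0 <= p * f i ^+ 2 + y by rewrite addr_ge0// mulr_ge0// sqr_ge0.
(* The cross term: after squaring, the induction hypothesis [x ^+ 2 <= p * y] reduces it to [4 * (p
   * f i ^+ 2) * y <= (p * f i ^+ 2 + y) ^+ 2]. *)
have key : 2 * (v i * f i * x) <= `|v i| * (p * f i ^+ 2 + y).
  rewrite (le_trans (ler_norm _))// !normrM normr_nat.
  rewrite [2 * _]mulrC -!mulrA ler_wpM2l// -ler_sqr ?nnegrE//.
  rewrite !exprMn !real_normK ?num_real//.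
  apply: (@le_trans _ _ (f i ^+ 2 * (p * y * 2 ^+ 2))).
    by rewrite ler_wpM2l ?sqr_ge0// ler_wpM2r ?sqr_ge0.
  rewrite -subr_ge0 [X in 0 <= X](_ : _ = (p * f i ^+ 2 - y) ^+ 2) ?sqr_ge0//.
  by ring.
have -> : (v i * f i + x) ^+ 2 = v i ^+ 2 * f i ^+ 2 + 2 * (v i * f i * x) + x ^+ 2.
  by ring.
rewrite -(real_normK (num_real (v i))).
by move: key IH; nra.
Qed.

Lemma Lnorm2_Rintegral {R : realType} {d : measure_display} {X : measurableType d}
    (mu : probability X R) (F : X -> R) :
  mu.-integrable setT (EFin \o (fun x => F x ^+ 2)) ->
  ('N[mu]_(2%:E)[EFin \o F] = (Num.sqrt (\int[mu]_x F x ^+ 2))%:E)%E.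
Proof.
move=> Fi; rewrite unlock /=.
have -> : (\int[mu]_x `|(F x)%:E| `^ 2 = (\int[mu]_x F x ^+ 2)%:E)%E.
  rewrite /Rintegral fineK; last exact: (integrable_fin_num _ Fi).
  apply: eq_integral => x _.
  by rewrite abse_EFin poweR_EFin powR_mulrn// real_normK ?num_real.
rewrite poweR_EFin powR12_sqrt//; apply: Rintegral_ge0 => x _; exact: sqr_ge0.
Qed.

(** * Weighted means *)

Section sums.
Context {R : realType}.
Implicit Types (A b u x y e F W : nat -> R).

(** A Toeplitz argument: terms [y] negligible against [x] have sums negligible against [A], since
    the sums of [x] are [O(A)] and any fixed initial segment disappears as [A] tends to infinity. *)
Lemma cvg_sum_dominated A x y e (K : R) : 0 <= K -> (forall n, 0 <= x n) ->
  A n @[n --> \oo] --> +oo ->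
  (forall n, \sum_(0 <= i < n) x i <= K * A n) ->
  e n @[n --> \oo] --> 0 -> (forall n, `|y n| <= e n * x n) ->
  (\sum_(0 <= i < n) y i) / A n @[n --> \oo] --> 0.
Proof.
move=> K0 x0 Aoo xA e0 ye; apply/cvgr0Pnorm_le => eps eps0.
(* Head and tail each receive half of [eps]; [K + 1] is used because [K] may vanish. *)
pose del := eps / (2 * (K + 1)).
have del0 : 0 < del by rewrite divr_gt0// mulr_gt0// ltr_wpDl.
have /cvgr0Pnorm_le/(_ _ del0)[N _ eN] := e0.
pose C := \sum_(0 <= i < N) `|y i|.
have C0 : 0 <= C by apply: sumr_ge0.
have /cvgryPge/(_ (2 * C / eps + 1)) := Aoo.
apply: filter_app; exists N => // n /= Nn An.
have An0 : 0 < A n.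
  by rewrite (lt_le_trans _ An)// ltr_wpDl// divr_ge0 ?mulr_ge0// ltW.
rewrite normrM normfV (gtr0_norm An0) ler_pdivrMr//.
rewrite (le_trans (ler_norm_sum _ _ _))// (big_cat_nat _ Nn)//= -/C.
have : \sum_(N <= i < n) `|y i| <= del * (K * A n).
  apply: (@le_trans _ _ (\sum_(N <= i < n) del * x i)).
    rewrite !big_nat; apply: ler_sum => i /andP[Ni _].
    by rewrite (le_trans (ye i))// ler_wpM2r// (le_trans (ler_norm _))// eN.
  rewrite -mulr_sumr ler_wpM2l//; first exact: ltW.
  by rewrite (le_trans _ (xA n))// [leRHS](big_cat_nat _ Nn)//= ler_wpDl// sumr_ge0.
have : C <= eps / 2 * A n.
  have : 2 * C / eps <= A n by rewrite (le_trans _ An)// lerDl.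
  by rewrite ler_pdivrMr//; lra.
have : del * (K * A n) <= eps / 2 * A n.
  rewrite mulrA ler_pM2r// /del -mulrA ler_pM2l//.
  by rewrite ler_pdivrMl ?mulr_gt0 ?ltr_wpDl//; lra.
lra.
Qed.

Lemma abel_summation u (S : nat -> R) n : 
  \sum_(0 <= i < n) u i * (S i.+1 - S i) =
  u n * S n - u 0 * S 0 - \sum_(0 <= i < n) (u i.+1 - u i) * S i.+1.
Proof.
elim: n => [|n IH]; first by rewrite !big_geq// subrr subr0.
by rewrite !big_nat_recr//= IH; ring.
Qed.

Definition monotone_seq u :=
  (forall n, u n <= u n.+1) \/ (forall n, u n.+1 <= u n).

(** Let [S] be the sums of [(b (i+1) - b i) * F i], so that [S = o(b)]. Abel summation leaves the
    boundary term [u n * S n], which is [o(W)] because [u * b = O(W)], and the sum of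
    [(u (i+1) - u i) * S (i+1)]. As [u] is monotone, the sum of [|u (i+1) - u i| * b (i+1)] is the
    absolute value of a signed sum, which a second Abel summation, with [b] in place of [S], bounds
    by [O(W)]. *)
Lemma weighted_sum_o u b W F (K : R) :
  (forall n, 1 <= b n) -> (forall n, b n < b n.+1) ->
  (forall n, 0 <= u n) -> monotone_seq u ->
  (forall n, 1 <= W n) -> W n @[n --> \oo] --> +oo ->
  (forall n, u n * b n <= K * W n) ->
  (forall n, \sum_(0 <= i < n) u i * (b i.+1 - b i) <= K * W n) ->
  (\sum_(0 <= i < n) (b i.+1 - b i) * F i) / b n @[n --> \oo] --> 0 ->
  (\sum_(0 <= i < n) u i * (b i.+1 - b i) * F i) / W n @[n --> \oo] --> 0.
Proof.
move=> b1 b_incr u0 mu W1 Woo ubK uK Fo.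
have b0 n : 0 < b n by exact: lt_le_trans (b1 n).
have W0 n : 0 < W n by exact: lt_le_trans (W1 n).
pose S n := \sum_(0 <= i < n) (b i.+1 - b i) * F i.
have K0 : 0 <= K.
  have := le_trans (mulr_ge0 (u0 0%N) (ltW (b0 0%N))) (ubK 0%N).
  by rewrite pmulr_lge0.
have -> : (fun n => (\sum_(0 <= i < n) u i * (b i.+1 - b i) * F i) / W n) =
    (fun n => u n * S n / W n -
              (\sum_(0 <= i < n) (u i.+1 - u i) * S i.+1) / W n).
  apply/funext => n; rewrite -mulrBl; congr (_ / _).
  have S0 : S 0%N = 0 by rewrite /S big_geq.
  have := abel_summation u S n; rewrite S0 mulr0 subr0 => <-.
  by apply: eq_bigr => i _; rewrite /S big_nat_recr//= addrAC subrr add0r mulrA.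
rewrite -[X in _ --> X](subr0 0); apply: cvgB.
  have /cvgr0Pnorm_le h := Fo; apply/cvgr0Pnorm_le => eps eps0.
  have /h : 0 < eps / (K + 1) by rewrite divr_gt0// ltr_wpDl.
  apply: filterS => n; rewrite -/(S n) normrM normfV (gtr0_norm (b0 n)).
  rewrite !ler_pdivrMr// => Sn.
  rewrite normrM normfV (gtr0_norm (W0 n)) ler_pdivrMr// normrM ger0_norm//.
  have -> : eps * W n = eps / (K + 1) * ((K + 1) * W n).
    by rewrite mulrA divfK// gt_eqF// ltr_wpDl.
  rewrite (le_trans (ler_wpM2l (u0 n) Sn))// mulrCA ler_wpM2l//.
    by rewrite ltW// divr_gt0// ltr_wpDl.
  by rewrite (le_trans (ubK n))// mulrDl lerDl mul1r ltW.
(* One [K] bounds [u n * b n] and the other the sum of [u i * (b (i+1) - b i)]; the initial value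
   [u 0 * b 0] is multiplied by [W n >= 1]. *)
apply: (@cvg_sum_dominated _ (fun i => `|u i.+1 - u i| * b i.+1) _
   (fun i => `|S i.+1 / b i.+1|) (2 * K + u 0 * b 0)).
- by rewrite addr_ge0 ?mulr_ge0// ltW.
- by move=> n; rewrite mulr_ge0// ltW.
- exact: Woo.
- move=> n.
  have -> : \sum_(0 <= i < n) `|u i.+1 - u i| * b i.+1 =
      `|\sum_(0 <= i < n) (u i.+1 - u i) * b i.+1|.
    have [mu'|mu'] := mu.
      rewrite ger0_norm; first by apply: eq_bigr => i _; rewrite ger0_norm ?subr_ge0.
      by apply: sumr_ge0 => i _; rewrite mulr_ge0 ?subr_ge0// ltW.
    rewrite ler0_norm -?sumrN.
      by apply: eq_bigr => i _; rewrite ler0_norm ?subr_le0// mulNr.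
    by apply: sumr_le0 => i _; rewrite mulr_le0_ge0 ?subr_le0// ltW.
  have := abel_summation u b n.
  have := uK n; have := ubK n.
  have : 0 <= \sum_(0 <= i < n) u i * (b i.+1 - b i).
    by apply: sumr_ge0 => i _; rewrite mulr_ge0// subr_ge0 ltW.
  have : 0 <= u n * b n by rewrite mulr_ge0// ltW.
  have : u 0 * b 0 <= u 0 * b 0 * W n by rewrite ler_peMr// mulr_ge0// ltW.
  have : 0 <= u 0 * b 0 by rewrite mulr_ge0// ltW.
  have : 0 <= K * W n by rewrite mulr_ge0// ltW.
  by rewrite mulrDl ler_norml; lra.
- by rewrite -(normr0 R); apply: cvg_norm; move: Fo; rewrite -cvg_shiftS.
- move=> n; rewrite !normrM normfV (gtr0_norm (b0 _)).
  by rewrite [_ * b n.+1]mulrC mulrA divfK ?gt_eqF// mulrC.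
Qed.

(** Since [s] climbs by at most one at a time, each integer is left at most once and entered at most
    once. The errors at the jumps thus involve each [|F m|] at most twice, with coefficients at most
    [b (n+1) - b n], which tend to [0]. *)
Lemma riemann_sum_cesaro (L : R) b (s : nat -> nat) F (K : R) :
  (forall n, 1 <= b n) -> (forall n, b n < b n.+1) -> b n @[n --> \oo] --> +oo ->
  (forall n, b n.+1 - b n < 1) -> b n.+1 - b n @[n --> \oo] --> 0 ->
  (forall n, (s n)%:R <= b n <= (s n).+1%:R) ->
  (\sum_(0 <= m < n) F m) / n%:R @[n --> \oo] --> L ->
  (forall n, \sum_(0 <= m < n) `|F m| <= K * n%:R) ->
  (\sum_(0 <= i < n) (b i.+1 - b i) * F (s i)) / b n @[n --> \oo] --> L.
Proof.
move=> b1 b_incr boo db1 db0 sb FL FK.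
have b0 n : 0 < b n by exact: lt_le_trans (b1 n).
have s_step n : s n.+1 = s n \/ s n.+1 = (s n).+1.
  have /andP[h1 h2] := sb n; have /andP[h3 h4] := sb n.+1.
  have : (s n < (s n.+1).+1)%N.
    by rewrite -(ltr_nat R) (le_lt_trans h1)// (lt_le_trans (b_incr n)).
  have : (s n.+1 < (s n).+2)%N.
    rewrite -(ltr_nat R) (le_lt_trans h3)// mulrSr.
    by have := db1 n; move: h2; lra.
  rewrite !ltnS => h5; rewrite leq_eqVlt => /predU1P[->|h6]; first by left.
  by right; apply/eqP; rewrite eqn_leq h5.
(* [H n] is the integral of [F (floor t)] over [0, b n]; it differs from the
   Riemann sum by [err], which vanishes unless [s] jumps at [n]. *)
pose H n := \sum_(0 <= m < s n) F m + (b n - (s n)%:R) * F (s n).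
pose err n := (b n.+1 - (s n.+1)%:R) * (F (s n.+1) - F (s n)).
pose x n := if s n.+1 == s n then 0 else `|F (s n)| + `|F (s n.+1)|.
have sumE n : \sum_(0 <= i < n) (b i.+1 - b i) * F (s i) =
    H n - H 0 - \sum_(0 <= i < n) err i.
  elim: n => [|n IH]; first by rewrite !big_geq// subrr subr0.
  rewrite !big_nat_recr//= IH /H /err.
  case: (s_step n) => ->; first by ring.
  by rewrite big_nat_recr//= mulrSr; ring.
have -> : (fun n => (\sum_(0 <= i < n) (b i.+1 - b i) * F (s i)) / b n) =
    (fun n => H n / b n - H 0%N / b n - (\sum_(0 <= i < n) err i) / b n).
  by apply/funext => n; rewrite sumE !mulrBl.
have binv : (b n)^-1 @[n --> \oo] --> 0.
  by apply/gtr0_cvgV0 => //; apply: nearW => n.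
rewrite -[X in _ --> X]subr0; apply: cvgB.
  rewrite -[X in _ --> X]subr0; apply: cvgB; last first.
    by rewrite -(mulr0 (H 0%N)); exact: cvgMr.
  apply/cvgrPdist_le => eps eps0.
  have /cvgrPdist_le/(_ _ eps0)[N _ hN] := FL.
  have big M : (N <= M)%N -> (0 < M)%N ->
      `|L * M%:R - \sum_(0 <= m < M) F m| <= eps * M%:R.
    move=> NM M0; have Mp : 0 < M%:R :> R by rewrite ltr0n.
    rewrite (_ : _ - _ = (L - (\sum_(0 <= m < M) F m) / M%:R) * M%:R).
      by rewrite normrM (gtr0_norm Mp) ler_pM2r//; exact: hN.
    by rewrite mulrBl divfK// gt_eqF.
  have /cvgryPge/(_ (N.+2)%:R) := boo; apply: filterS => n bN.
  have /andP[sb1 sb2] := sb n.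
  have Ns : (N < s n)%N by rewrite -ltnS -(ler_nat R) (le_trans bN).
  have h1 := big _ (ltnW Ns) (leq_ltn_trans (leq0n _) Ns).
  have h2 := big (s n).+1 (leqW (ltnW Ns)) isT.
  have bn0 := b0 n; rewrite (_ : _ - _ = (L * b n - H n) / b n); last first.
    by rewrite mulrBl mulfK// gt_eqF.
  rewrite normrM normfV (gtr0_norm bn0) ler_pdivrMr//.
  set t := b n - (s n)%:R; have t0 : 0 <= t by rewrite subr_ge0.
  have t1 : 0 <= 1 - t by move: sb2; rewrite /t mulrSr; lra.
  (* [H n] interpolates between two consecutive sums of [F]. *)
  have -> : L * b n - H n =
      (1 - t) * (L * (s n)%:R - \sum_(0 <= m < s n) F m) +
      t * (L * (s n).+1%:R - \sum_(0 <= m < (s n).+1) F m).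
    by rewrite big_nat_recr//= /H -/t /t mulrSr; ring.
  have -> : eps * b n = (1 - t) * (eps * (s n)%:R) + t * (eps * (s n).+1%:R).
    by rewrite /t mulrSr; ring.
  rewrite (le_trans (ler_normD _ _))// !normrM (ger0_norm t0) (ger0_norm t1).
  by apply: lerD; rewrite ler_wpM2l.
(* The sums of [|F|] up to [s n] and [s n + 1] total at most [K * (2 * s n + 1)], and both [s n] and
   [1] are at most [b n]. *)
apply: (@cvg_sum_dominated _ x _ (fun n => b n.+1 - b n) (3 * K)).
- by rewrite mulr_ge0//; have := FK 1; rewrite mulr1 big_nat1; exact: le_trans.
- by move=> n; rewrite /x; case: ifP.
- exact: boo.
- move=> n; have xs : \sum_(0 <= i < n) x i <=
      \sum_(0 <= m < s n) `|F m| + \sum_(0 <= m < (s n).+1) `|F m|.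
    elim: n => [|n IH]; first by rewrite big_geq//; apply: addr_ge0; apply: sumr_ge0.
    rewrite big_nat_recr//= {2}/x; case: (s_step n) => ->.
      by rewrite eqxx addr0.
    rewrite gtn_eqF//= !(big_nat_recr (s n).+1)//= (big_nat_recr (s n))//= in IH *.
    by move: IH; lra.
  rewrite (le_trans xs)//; have := FK (s n); have := FK (s n).+1.
  have K0 : 0 <= K by have := FK 1; rewrite mulr1 big_nat1; exact: le_trans.
  have /andP[sbn _] := sb n.
  have : K * (s n)%:R <= K * b n by rewrite ler_wpM2l.
  have : K <= K * b n by rewrite ler_peMr.
  by rewrite mulrSr; lra.
- exact: db0.
(* At a jump the new integer [s n + 1] is at least [b n], so [b (n+1)] exceeds it by at most the
   increment of [b]. *)
- move=> n; have /andP[sb1 _] := sb n.+1; have /andP[_ sb2] := sb n.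
  rewrite /err /x; case: (s_step n) => sE; move: sb1; rewrite sE => sb1.
    by rewrite eqxx subrr mulr0 normr0 mulr0.
  rewrite gtn_eqF// normrM ler_pM//.
    by rewrite ger0_norm ?subr_ge0// lerD2l lerN2.
  by rewrite [leRHS]addrC; exact: ler_normB.
Qed.

(** The exact weights [u n * (b (n+1) - b n)] are treated after subtracting the limit, and the
    factor [rho] is then restored. Its error [(rho - 1) * u * (b (n+1) - b n) * F] is negligible
    once the weighted means of [|F|] are bounded, which the same argument provides when run on
    [|F|]. *)
Lemma weighted_average_cvg (L L' : R) b (s : nat -> nat) F u rho w W (K : R) :
  (forall n, 1 <= b n) -> (forall n, b n < b n.+1) -> b n @[n --> \oo] --> +oo ->
  (forall n, b n.+1 - b n < 1) -> b n.+1 - b n @[n --> \oo] --> 0 ->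
  (forall n, (s n)%:R <= b n <= (s n).+1%:R) ->
  (forall n, 0 <= u n) -> monotone_seq u ->
  (forall n, 1 <= W n) -> W n @[n --> \oo] --> +oo ->
  (forall n, u n * b n <= K * W n) ->
  (forall n, \sum_(0 <= i < n) u i * (b i.+1 - b i) <= K * W n) ->
  (forall n, w n = rho n * (u n * (b n.+1 - b n))) -> rho n @[n --> \oo] --> (1 : R) ->
  (\sum_(0 <= i < n) w i) / W n @[n --> \oo] --> (1 : R) ->
  (\sum_(0 <= m < n) F m) / n%:R @[n --> \oo] --> L ->
  (\sum_(0 <= m < n) `|F m|) / n%:R @[n --> \oo] --> L' ->
  (\sum_(0 <= i < n) w i * F (s i)) / W n @[n --> \oo] --> L.
Proof.
move=> b1 b_incr boo db1 db0 sb u0 mu W1 Woo ubK uK wE rho1 wW FL FL'.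
have b0 n : 0 < b n by exact: lt_le_trans (b1 n).
have W0 n : 0 < W n by exact: lt_le_trans (W1 n).
have [B B0 FB] : exists2 B, 0 <= B & forall n, \sum_(0 <= m < n) `|F m| <= B * n%:R.
  have /cvg_seq_bounded/pinfty_ex_gt0[B B0 /= FB] : cvgn
    (fun n => (\sum_(0 <= m < n) `|F m|) / n%:R) by apply/cvg_ex; exists L'.
  exists B; first exact: ltW.
  move=> [|n]; first by rewrite big_geq// mulr0.
  by rewrite -ler_pdivrMr// (le_trans (ler_norm _))//; exact: FB.
pose al n := b n.+1 - b n.
have al0 n : 0 <= al n by rewrite subr_ge0 ltW.
have ual0 n : 0 <= u n * al n by rewrite mulr_ge0.
have bW n : \sum_(0 <= i < n) al i = b n - b 0%N by rewrite telescope_sumr.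
have main G M : (\sum_(0 <= m < n) G m) / n%:R @[n --> \oo] --> M ->
    (forall n, \sum_(0 <= m < n) `|G m| <= B * n%:R) ->
    (\sum_(0 <= i < n) u i * al i * (G (s i) - M)) / W n @[n --> \oo] --> 0.
  move=> GM GB; apply: (@weighted_sum_o _ _ _ (fun i => G (s i) - M) K) => //.
  have := riemann_sum_cesaro b1 b_incr boo db1 db0 sb GM GB.
  have binv : (b n)^-1 @[n --> \oo] --> 0.
    by apply/gtr0_cvgV0 => //; apply: nearW => n.
  (* The increments sum to [b n - b 0], not [b n], whence the correction to the mean of the constant
     [M]. *)
  have h : M * (1 - b 0%N * (b n)^-1) @[n --> \oo] --> M * (1 - b 0%N * 0).
    by apply: cvgMr; apply: cvgB; [exact: cvg_cst|exact: cvgMr].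
  rewrite mulr0 subr0 mulr1 in h.
  move=> /cvgB/(_ h); rewrite subrr.
  apply: cvg_trans; apply: near_eq_cvg; apply: nearW => n /=.
  change ((\sum_(0 <= i < n) al i * G (s i)) / b n - M * (1 - b 0%N / b n) =
    (\sum_(0 <= i < n) al i * (G (s i) - M)) / b n).
  have -> : M * (1 - b 0%N / b n) = (M * \sum_(0 <= i < n) al i) / b n.
    by rewrite bW; field; rewrite gt_eqF.
  rewrite -mulrBl; congr (_ / _); rewrite mulr_sumr -sumrB.
  by apply: eq_bigr => i _; ring.
have K0 : 0 <= K.
  have := le_trans (mulr_ge0 (u0 0%N) (ltW (b0 0%N))) (ubK 0%N).
  by rewrite pmulr_lge0.
have e1 : `|rho n - 1| @[n --> \oo] --> 0.
  by rewrite -(normr0 R); apply: cvg_norm; rewrite -(subrr 1); apply: cvgB => //; exact: cvg_cst.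
have ualW : (\sum_(0 <= i < n) u i * al i) / W n @[n --> \oo] --> (1 : R).
  have h : forall n, `|w n - u n * al n| <= `|rho n - 1| * (u n * al n).
    move=> n; rewrite wE -/(al n) -{2}(mul1r (u n * al n)) -mulrBl normrM.
    by rewrite (ger0_norm (ual0 n)).
  have /(cvgB wW) := cvg_sum_dominated K0 ual0 Woo uK e1 h.
  rewrite subr0; apply: cvg_trans; apply: near_eq_cvg; apply: nearW => n /=.
  change ((\sum_(0 <= i < n) w i) / W n -
    (\sum_(0 <= i < n) (w i - u i * al i)) / W n = (\sum_(0 <= i < n) u i * al i) / W n).
  by rewrite -mulrBl -sumrB; congr (_ / _); apply: eq_bigr => i _; ring.
have [C C0 uFC] : exists2 C, 0 <= C & forall n,
    \sum_(0 <= i < n) u i * al i * `|F (s i)| <= C * W n.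
  have FB' n : \sum_(0 <= m < n) `| `|F m| | <= B * n%:R.
    by under eq_bigr do rewrite normr_id.
  have h := main _ _ FL' FB'.
  have /cvg_seq_bounded/pinfty_ex_gt0[C C0 /= hC] := cvgP _ h.
  exists (C + `|L'| * K); first by rewrite addr_ge0 ?mulr_ge0// ltW.
  move=> n; have := hC n I => /(le_trans (ler_norm _)).
  rewrite ler_pdivrMr//.
  have -> : \sum_(0 <= i < n) u i * al i * (`|F (s i)| - L') =
     \sum_(0 <= i < n) u i * al i * `|F (s i)| -
     L' * \sum_(0 <= i < n) u i * al i.
    by rewrite mulr_sumr -sumrB; apply: eq_bigr => i _; ring.
  have : L' * \sum_(0 <= i < n) u i * al i <= `|L'| * (K * W n).
    rewrite (le_trans (ler_wpM2r _ (ler_norm _)))//; first exact: sumr_ge0.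
    by rewrite ler_wpM2l.
  lra.
(* Perturbation of the weights, fluctuation of [F] around [L], and total mass: the first two tend to
   [0] and the mass to [1]. *)
have -> : (fun n => (\sum_(0 <= i < n) w i * F (s i)) / W n) = (fun n =>
    (\sum_(0 <= i < n) (w i - u i * al i) * F (s i)) / W n +
    (\sum_(0 <= i < n) u i * al i * (F (s i) - L)) / W n +
    L * ((\sum_(0 <= i < n) u i * al i) / W n)).
  apply/funext => n; rewrite mulrA -!mulrDl; congr (_ / _).
  by rewrite mulr_sumr -!big_split/=; apply: eq_bigr => i _; ring.
have h1 : (\sum_(0 <= i < n) (w i - u i * al i) * F (s i)) / W n @[n --> \oo] --> 0.
  apply: (@cvg_sum_dominated W (fun i => u i * al i * `|F (s i)|) _ _ C C0 _ Woo uFC e1).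
    by move=> n; rewrite mulr_ge0.
  move=> n; rewrite wE -/(al n) -{2}(mul1r (u n * al n)) -mulrBl !normrM.
  by rewrite (ger0_norm (u0 n)) (ger0_norm (al0 n)) -!mulrA.
have h2 : L * ((\sum_(0 <= i < n) u i * al i) / W n) @[n --> \oo] --> L * 1.
  exact: cvgMr.
by have := cvgD (cvgD h1 (main _ _ FL FB)) h2; rewrite addr0 add0r mulr1; exact.
Qed.

End sums.

(** * Hardy fields *)

Section near_pinfty.
Context {R : realType}.
Implicit Types f df : R -> R.

Lemma near_pinfty_ge (P : R -> Prop) : (\forall x \near +oo, P x) ->
  \forall M \near +oo, forall x, M <= x -> P x.
Proof.
move=> [M [Mr MP]]; exists M; split => // N MN x Nx.
by apply: MP; exact: lt_le_trans Nx.
Qed.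

Lemma is_derive_continuous_ge f df (M : R) :
  (forall x, M <= x -> is_derive (x : R) 1 f (df x)) ->
  {within `[M, +oo[, continuous f}.
Proof.
move=> fdf; apply: derivable_within_continuous => x.
by rewrite in_itv/= andbT => /fdf[].
Qed.

Lemma MVT_ge f df (M x y : R) :
  (forall x, M <= x -> is_derive (x : R) 1 f (df x)) -> M <= x -> x < y ->
  exists c, [/\ x < c, c < y & f y - f x = df c * (y - x)].
Proof.
move=> fdf Mx xy; have [||c] := @MVT _ f df x y xy.
- by move=> z; rewrite in_itv/= => /andP[/ltW xz _]; exact/fdf/(le_trans Mx).
- apply: continuous_subspaceW (is_derive_continuous_ge fdf) => z /=.
  by rewrite !in_itv/= andbT => /andP[xz _]; exact: le_trans xz.
- by rewrite in_itv/= => /andP[xc cy] E; exists c.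
Qed.

Lemma near_derive_ge0 f df : (\forall x \near +oo, is_derive (x : R) 1 f (df x)) ->
  (\forall x \near +oo, 0 <= df x) ->
  \forall M \near +oo, forall x y, M <= x -> x <= y -> f x <= f y.
Proof.
move=> /near_pinfty_ge fdf /near_pinfty_ge df0; near=> M => x y Mx.
have fdfM : forall x, M <= x -> is_derive (x : R) 1 f (df x) by near: M.
have df0M : forall x, M <= x -> 0 <= df x by near: M.
rewrite le_eqVlt => /predU1P[->//|xy].
have [c [xc _ fxy]] := MVT_ge fdfM Mx xy.
rewrite -subr_ge0 fxy mulr_ge0 ?subr_ge0 ?(ltW xy)//.
by apply: df0M; rewrite (le_trans Mx)// ltW.
Unshelve. all: by end_near. Qed.

Lemma near_derive_le0 f df : (\forall x \near +oo, is_derive (x : R) 1 f (df x)) ->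
  (\forall x \near +oo, df x <= 0) ->
  \forall M \near +oo, forall x y, M <= x -> x <= y -> f y <= f x.
Proof.
move=> fdf df0.
have := @near_derive_ge0 (\- f) (\- df).
have h1 : \forall x \near +oo, is_derive (x : R) 1 (\- f) (- df x).
  by apply: filterS fdf => x h; exact: is_deriveN.
have h2 : \forall x \near +oo, 0 <= - df x.
  by apply: filterS df0 => x h; rewrite oppr_ge0.
move=> /(_ h1 h2); apply: filterS => M h x y Mx xy.
by rewrite -lerN2; exact: h.
Qed.

End near_pinfty.

(** * Maximal extensions and signs of germs *)

Section Hardy.
Context {R : realType}.
Implicit Types (H : set (R -> R)) (f g : R -> R).

(** Zorn's lemma is run on the sets [A] for which [H] together with [A] is a Hardy field: the empty
    chain, whose union is empty, is then admissible. *)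
Lemma maximal_Hardy_field_ext H : Hardy_field H ->
  exists2 K, maximal_Hardy_field K & H `<=` K.
Proof.
move=> HH; pose P A := Hardy_field (H `|` A).
have [F FP Ftot|A [PA maxA]] := @Zorn_bigcup _ P.
  rewrite /P; set U := H `|` _.
  (* Each closure condition involves at most two elements, which share a Hardy field of the
     chain. *)
  have join f g : U f -> U g ->
      exists Y, [/\ Hardy_field Y, Y f, Y g & Y `<=` U].
    have HX X : F X -> H `|` X `<=` U.
      by move=> FX x [Hx|Xx]; [left|right; exists X].
    move=> [Hf|[X FX Xf]] [Hg|[Y FY Yg]].
    - by exists H; split => //; exact: subsetUl.
    - by exists (H `|` Y); split; [exact: FP|left|right|exact: HX].
    - by exists (H `|` X); split; [exact: FP|right|left|exact: HX].
    - have [XY|YX] := Ftot _ _ FX FY.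
      + by exists (H `|` Y); split; [exact: FP|right; exact: XY|right|exact: HX].
      + by exists (H `|` X); split; [exact: FP|right|right; exact: YX|exact: HX].
  split.
  - by move=> f Uf; have [Y [HY Yf _ _]] := join f f Uf Uf; exact: (Hardy_germB HY).
  - move=> f g Uf fg; have [Y [HY Yf _ YU]] := join f f Uf Uf.
    by apply: YU; exact: (Hardy_saturated HY Yf).
  - by left; exact: Hardy_one.
  - move=> f g Uf Ug; have [Y [HY Yf Yg YU]] := join f g Uf Ug.
    by apply: YU; exact: Hardy_sub.
  - move=> f g Uf Ug; have [Y [HY Yf Yg YU]] := join f g Uf Ug.
    by apply: YU; exact: Hardy_mul.
  - move=> f Uf f0; have [Y [HY Yf _ YU]] := join f f Uf Uf.
    by have [g Yg fg] := Hardy_inv HY Yf f0; exists g => //; exact: YU.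
  - by move=> f Uf; have [Y [HY Yf _ _]] := join f f Uf Uf; exact: (Hardy_derivable HY).
  - move=> f Uf; have [Y [HY Yf _ YU]] := join f f Uf Uf.
    by apply: YU; exact: Hardy_derive.
exists (H `|` A); last exact: subsetUl.
split=> // K HK HAK; apply/seteqP; split=> // f Kf; right.
have [|KA] := pselect (K `<=` A); first exact.
have [] := maxA K; last by rewrite /P setUidr//; exact: subset_trans HAK.
by split => //; exact: subset_trans HAK.
Qed.

Context (H : set (R -> R)) (HH : Hardy_field H).

Lemma Hardy_zero : H (cst 0).
Proof.
have := Hardy_sub HH (Hardy_one HH) (Hardy_one HH).
by congr H; apply/funext => x /=; rewrite subrr.
Qed.

Lemma Hardy_opp f : H f -> H (\- f).
Proof.
move=> Hf; have := Hardy_sub HH Hardy_zero Hf.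
by congr H; apply/funext => x /=; rewrite sub0r.
Qed.

Lemma Hardy_add f g : H f -> H g -> H (f \+ g).
Proof.
move=> Hf Hg; have := Hardy_sub HH Hf (Hardy_opp Hg).
by congr H; apply/funext => x /=; rewrite opprK.
Qed.

Lemma Hardy_natr n : H (cst n%:R).
Proof.
elim: n => [|n IH]; first exact: Hardy_zero.
have := Hardy_add IH (Hardy_one HH).
by congr H; apply/funext => x /=; rewrite mulrSr.
Qed.

Lemma Hardy_is_derive f : H f -> \forall x \near +oo, is_derive (x : R) 1 f (derive1 f x).
Proof.
move=> Hf; have := Hardy_derivable HH Hf; apply: filterS => x fx.
by rewrite derive1E; exact: derivableP.
Qed.

(** A nonzero germ is invertible, so it has no zeros near infinity; being differentiable there, it
    is continuous and keeps its sign by the intermediate value theorem. *)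
Lemma Hardy_sign f : H f -> [\/ \forall x \near +oo, f x = 0,
  \forall x \near +oo, 0 < f x | \forall x \near +oo, f x < 0].
Proof.
move=> Hf; have [f0|f0] := pselect (germ_eq f (cst 0)); first by constructor 1.
have [g _ fg] := Hardy_inv HH Hf f0.
have /near_pinfty_ge nz : \forall x \near +oo, f x != 0.
  apply: filterS fg => x /=; apply: contra_eq_neq => ->.
  by rewrite mul0r eq_sym oner_neq0.
have /near_pinfty_ge fdf := Hardy_is_derive Hf.
near (pinfty_nbhs R) => M.
have nzM : forall x, M <= x -> f x != 0 by near: M.
have fdfM : forall x, M <= x -> is_derive (x : R) 1 f (derive1 f x) by near: M.
have cst_sign x : M <= x -> 0 < f M * f x.
  move=> Mx; rewrite ltNge; apply/negP => fMx.
  have [||c] := @IVT _ f M x 0 Mx.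
  - apply: continuous_subspaceW (is_derive_continuous_ge fdfM) => z /=.
    by rewrite !in_itv/= andbT => /andP[].
  - rewrite ge_min le_max; move: (nzM _ Mx) (nzM _ (lexx M)).
    rewrite !neq_lt => /orP[fx|fx] /orP[fM|fM].
    + by move: fMx; rewrite leNgt nmulr_rgt0// fx.
    + by rewrite (ltW fx) (ltW fM) !orbT.
    + by rewrite (ltW fx) (ltW fM) !orbT.
    + by move: fMx; rewrite leNgt pmulr_rgt0// fx.
  - by rewrite in_itv/= => /andP[Mc _] /eqP; rewrite (negbTE (nzM _ Mc)).
have := nzM _ (lexx M); rewrite neq_lt => /orP[fM|fM]; [constructor 3|constructor 2].
- near=> x; have := cst_sign x; rewrite nmulr_rgt0//; apply; near: x.
  exact: nbhs_pinfty_ge.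
- near=> x; have := cst_sign x; rewrite pmulr_rgt0//; apply; near: x.
  exact: nbhs_pinfty_ge.
Unshelve. all: by end_near. Qed.

End Hardy.

(** * Growth of germs in a Hardy field *)

Section Hardy_growth.
Context {R : realType}.
Implicit Types b W f : R -> R.

Lemma near_derive_le0_bounded f df :
  (\forall x \near +oo, is_derive (x : R) 1 f (df x)) ->
  (\forall x \near +oo, df x <= 0) -> exists C, \forall x \near +oo, f x <= C.
Proof.
move=> fdf df0; have [M fM] := filter_ex (near_derive_le0 fdf df0).
by exists (f M); near=> x; apply: fM => //; near: x; exact: nbhs_pinfty_ge.
Unshelve. all: by end_near. Qed.

Lemma cvg_pinfty_unbounded b (C : R) :
  b x @[x --> +oo] --> +oo -> (\forall x \near +oo, b x <= C) -> False.
Proof.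
move=> /cvgryPgt/(_ C) h1 h2; suff [] : exists2 x : R, C < b x & b x <= C.
  by move=> x h /(lt_le_trans h); rewrite ltxx.
by have [x []] := filter_ex (filterI h1 h2); exists x.
Qed.

Context {H : set (R -> R)} (HH : Hardy_field H).

Lemma Hardy_derive_gt0 b : H b -> b x @[x --> +oo] --> +oo ->
  \forall x \near +oo, 0 < derive1 b x.
Proof.
move=> Hb boo; suff h : (\forall x \near +oo, derive1 b x <= 0) -> False.
  have [h'|//|h'] := Hardy_sign HH (Hardy_derive HH Hb); exfalso; apply: h;
    apply: filterS h' => x; [by move=> ->|exact: ltW].
move=> /(near_derive_le0_bounded (Hardy_is_derive HH Hb))[C].
exact: cvg_pinfty_unbounded.
Qed.

(** Otherwise [b'] would be positive and eventually nondecreasing, and [b] would grow at least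
    linearly, against [b x / x --> 0]. *)
Lemma Hardy_derive2_le0 b : H b -> b x @[x --> +oo] --> +oo ->
  b x / x @[x --> +oo] --> 0 -> \forall x \near +oo, derive1 (derive1 b) x <= 0.
Proof.
move=> Hb boo bx0; have Hb' := Hardy_derive HH Hb.
have [h|h|h] := Hardy_sign HH (Hardy_derive HH Hb').
- by apply: filterS h => x ->.
- exfalso; have db'0 : \forall x \near +oo, 0 <= derive1 (derive1 b) x.
    by apply: filterS h => x; exact: ltW.
  have mono := near_derive_ge0 (Hardy_is_derive HH Hb') db'0.
  have bder := near_pinfty_ge (Hardy_is_derive HH Hb).
  have b'0 := near_pinfty_ge (Hardy_derive_gt0 Hb boo).
  have /near_pinfty_ge b0 : \forall x \near +oo, 0 <= b x by move/cvgryPge : boo; exact.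
  have [M [[[monoM bderM] b'M] bM]] :=
    filter_ex (filterI (filterI (filterI mono bder) b'0) b0).
  pose e := derive1 b M / 2.
  have e0 : 0 < e by rewrite divr_gt0// b'M.
  have /cvgr0Pnorm_lt/(_ _ e0) bxe := bx0.
  (* Beyond [2 * M] one has [x - M >= x / 2], which matches the factor [1 / 2] in [e]. *)
  have xbig : \forall x \near +oo, Num.max (2 * M) (Num.max M 0) < x.
    by apply: nbhs_pinfty_gt; exact: num_real.
  have [x [+]] := filter_ex (filterI bxe xbig).
  rewrite !gt_max => + /and3P[x2M Mx x0].
  apply/negP; rewrite -leNgt (le_trans _ (ler_norm _))// ler_pdivlMr//.
  have [c [Mc _ E]] := MVT_ge bderM (lexx M) Mx.
  have : derive1 b M * (x - M) <= derive1 b c * (x - M).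
    by rewrite ler_wpM2r ?subr_ge0 ?(ltW Mx)// monoM// ltW.
  have : e * x <= derive1 b M * (x - M).
    by rewrite /e -mulrA ler_pM2l ?b'M//; lra.
  by have := bM _ (lexx M); lra.
- by apply: filterS h => x; exact: ltW.
Qed.

(** As [b'] is nonincreasing, [b' x * (x / 2) <= b' x * (x - M) <= b x - b M <= b x], so [b' x] is
    at most [2 * (b x / x)]. *)
Lemma Hardy_derive_cvg0 b : H b -> b x @[x --> +oo] --> +oo ->
  b x / x @[x --> +oo] --> 0 -> derive1 b x @[x --> +oo] --> 0.
Proof.
move=> Hb boo bx0.
have mono := near_derive_le0 (Hardy_is_derive HH (Hardy_derive HH Hb))
                             (Hardy_derive2_le0 Hb boo bx0).
have bder := near_pinfty_ge (Hardy_is_derive HH Hb).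
have /near_pinfty_ge b0 : \forall x \near +oo, 0 <= b x by move/cvgryPge : boo; exact.
have [M [[monoM bderM] bM]] := filter_ex (filterI (filterI mono bder) b0).
apply/cvgr0Pnorm_le => e e0.
have e20 : 0 < e / 2 by rewrite divr_gt0.
have /cvgr0Pnorm_lt/(_ _ e20) := bx0.
have xbig : \forall x \near +oo, Num.max (2 * M) (Num.max M 0) < x.
  by apply: nbhs_pinfty_gt; exact: num_real.
move: xbig (Hardy_derive_gt0 Hb boo); apply: filterS3 => x.
rewrite !gt_max => /and3P[x2M Mx x0] b'0.
rewrite (gtr0_norm b'0) normrM normfV (gtr0_norm x0) ltr_pdivrMr//.
rewrite (ger0_norm (bM _ (ltW Mx))) => bxe.
have [c [Mc cx E]] := MVT_ge bderM (lexx M) Mx.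
have : derive1 b x * (x / 2) <= derive1 b x * (x - M) by rewrite ler_pM2l//; lra.
have : derive1 b x * (x - M) <= derive1 b c * (x - M).
  by rewrite ler_wpM2r ?subr_ge0 ?(ltW Mx)// monoM// ltW.
have := bM _ (lexx M) => h1 h2 h3.
by rewrite -(ler_pM2r x0); lra.
Qed.

(* Otherwise [k b' + b] would be eventually nonincreasing, hence bounded. *)
Lemma Hardy_derive2_small b (k : nat) : H b -> b x @[x --> +oo] --> +oo ->
  \forall x \near +oo, 0 <= k%:R * derive1 (derive1 b) x + derive1 b x.
Proof.
move=> Hb boo; have Hb' := Hardy_derive HH Hb.
pose h := (cst k%:R \* derive1 (derive1 b)) \+ derive1 b.
have Hh : H h.
  by apply: (Hardy_add HH) => //; apply: (Hardy_mul HH);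
    [exact: Hardy_natr|exact: Hardy_derive].
have [h0|h0|h0] := Hardy_sign HH Hh; [by apply: filterS h0 => x /= <-|
  by apply: filterS h0 => x /ltW|exfalso].
pose phi := (fun x => k%:R * derive1 b x + b x).
have phi_der : \forall x \near +oo, is_derive (x : R) 1 phi (h x).
  move: (Hardy_is_derive HH Hb) (Hardy_is_derive HH Hb').
  apply: filterS2 => x d1 d2.
  exact: (is_deriveD (is_deriveZ k%:R d2) d1).
have [|C phiC] := near_derive_le0_bounded phi_der.
  by apply: filterS h0 => x /ltW.
apply: (@cvg_pinfty_unbounded b C) => //.
move: (Hardy_derive_gt0 Hb boo) phiC; apply: filterS2 => x b'0.
by apply: le_trans; rewrite /phi lerDr mulr_ge0// ltW.
Qed.

(* Otherwise [W / b ^+ k.+1], which is at most [1 / b], would be eventually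
   nondecreasing. *)
Lemma Hardy_log_growth b W (k : nat) : H b -> H W ->
  b x @[x --> +oo] --> +oo ->
  (\forall x \near +oo, 0 < W x) ->
  (\forall x \near +oo, W x <= b x ^+ k) ->
  \forall x \near +oo, derive1 W x * b x <= k.+1%:R * W x * derive1 b x.
Proof.
move=> Hb HW boo W0 Wb.
pose h := (derive1 W \* b) \- (cst k.+1%:R \* W \* derive1 b).
have Hh : H h.
  by apply: (Hardy_sub HH); repeat (apply: (Hardy_mul HH) => //);
    [exact: Hardy_derive|exact: Hardy_natr|exact: Hardy_derive].
have [h0|h0|h0] := Hardy_sign HH Hh; [
  by apply: filterS h0 => x /eqP; rewrite subr_eq0 => /eqP /= ->|exfalso|by apply: filterS h0 => x /ltW; rewrite subr_le0].
pose phi x := W x * (b x)^-1 ^+ k.+1.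
have b0 : \forall x \near +oo, 0 < b x by move/cvgryPgt : boo; exact.
have phi_der : \forall x \near +oo, is_derive (x : R) 1 phi ((b x)^-1 ^+ k.+2 * h x).
  move: (Hardy_is_derive HH Hb) (Hardy_is_derive HH HW) b0.
  apply: filterS3 => x d1 d2 bx0.
  have bx : b x != 0 by rewrite gt_eqF.
  have d := is_deriveM d2 (is_deriveX k.+1 (is_deriveV bx d1)).
  have -> : phi = W * (fun y => (b y)^-1) ^+ k.+1.
    by apply/funext => y; rewrite /phi mulrfctE exprfctE.
  apply: (is_derive_eq d); rewrite /h /= exprfctE /GRing.scale /=.
  have gb : (b x)^-1 * b x = 1 by rewrite mulVf.
  rewrite -[b x ^- 2]exprVn; move: gb; set g := (b x)^-1 => gb.
  transitivity (g ^+ k.+1 * derive1 W x * (g * b x) -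
    g ^+ k.+2 * (k.+1%:R * W x * derive1 b x)); last by rewrite !exprS; ring.
  by rewrite gb !exprS expr0; ring.
have mono : \forall M \near +oo, forall x y, M <= x -> x <= y -> phi x <= phi y.
  apply: near_derive_ge0 phi_der _; move: b0 h0; apply: filterS2 => x bx0 hx0.
  by rewrite mulr_ge0 ?(ltW hx0)// exprn_ge0// invr_ge0 ltW.
have [M [[[monoM bM] WM] WbM]] := filter_ex (filterI (filterI (filterI mono
  (near_pinfty_ge b0)) (near_pinfty_ge W0)) (near_pinfty_ge Wb)).
have phiM0 : 0 < phi M by rewrite mulr_gt0 ?WM ?exprn_gt0 ?invr_gt0 ?bM.
apply: (@cvg_pinfty_unbounded b (phi M)^-1) => //.
near=> x; have Mx : M <= x by near: x; apply: nbhs_pinfty_ge; exact: num_real.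
have bx := bM _ Mx.
rewrite -[leLHS]invrK lef_pV2 ?posrE ?invr_gt0//.
rewrite (le_trans (monoM _ _ (lexx M) Mx))// /phi.
rewrite (le_trans (ler_wpM2r _ (WbM _ Mx)))//; first by rewrite exprn_ge0// invr_ge0 ltW.
by rewrite exprSr mulrA -exprMn mulfV ?gt_eqF// expr1n mul1r.
Unshelve. all: by end_near. Qed.

(** The quotient [W' / b'] is itself a germ of the field, so its derivative has an eventual sign. *)
Lemma Hardy_quotient_monotone W b : H W -> H b ->
  (\forall x \near +oo, 0 < derive1 b x) ->
  let u x := derive1 W x / derive1 b x in
  (\forall M \near +oo, forall x y, M <= x -> x <= y -> u x <= u y) \/
  (\forall M \near +oo, forall x y, M <= x -> x <= y -> u y <= u x).
Proof.
move=> HW Hb b'0 u; have Hb' := Hardy_derive HH Hb.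
have [|g Hg gb] := Hardy_inv HH Hb'.
  move=> h; have [x []] := filter_ex (filterI b'0 h).
  by move=> + /= E; rewrite E ltxx.
have Hu : H u.
  apply: (Hardy_saturated HH (Hardy_mul HH (Hardy_derive HH HW) Hg)).
  move: b'0 gb; apply: filterS2 => x b0 /= E.
  by rewrite /u -[RHS]mulr1 -E mulrA divfK// gt_eqF.
have udu := Hardy_is_derive HH Hu.
have [h|h|h] := Hardy_sign HH (Hardy_derive HH Hu).
- by left; apply: near_derive_ge0 udu _; apply: filterS h => x ->.
- by left; apply: near_derive_ge0 udu _; apply: filterS h => x /ltW.
- by right; apply: near_derive_le0 udu _; apply: filterS h => x /ltW.
Qed.

End Hardy_growth.

(** * From germs to averages over the integers *)

Section Hardy_average.
Context {R : realType} {H : set (R -> R)} (HH : Hardy_field H).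
Variables (b W : R -> R) (k : nat) (s : nat -> nat).
Hypothesis Hb : H b.
Hypothesis HW : H W.
Hypothesis boo : b x @[x --> +oo] --> +oo.
Hypothesis bx0 : b x / x @[x --> +oo] --> 0.
Hypothesis w0 : \forall x \near +oo, 0 < derive1 W x.
Hypothesis w_nincr : \forall M \near +oo,
     forall x y : R, M <= x -> x <= y -> derive1 W y <= derive1 W x.
Hypothesis Woo : W x @[x --> +oo] --> +oo.
Hypothesis Wb : \forall x \near +oo, W x <= b x ^+ k.
Hypothesis sb : \forall n \near \oo, (s n)%:R <= b n%:R <= (s n).+1%:R.

Lemma cvg_nat_shift_pinfty (f : R -> R) (l : set_system R) n0 :
  f x @[x --> +oo] --> l -> f (n0 + n)%:R @[n --> \oo] --> l.
Proof.
move=> fl; apply: cvg_comp fl; apply: (@cvg_comp _ _ _ (addn n0) (fun n => n%:R)).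
  exact: cvg_addnl.
exact: cvgr_idn.
Qed.

Lemma MVT_nat (f df : R -> R) (M : R) n :
  (forall x, M <= x -> is_derive (x : R) 1 f (df x)) -> M <= n%:R ->
  exists c, [/\ n%:R < c, c < n.+1%:R & f n.+1%:R - f n%:R = df c].
Proof.
move=> fdf Mn; have [|c [nc cn E]] := MVT_ge fdf Mn (y := n.+1%:R).
  by rewrite ltr_nat.
by exists c; split => //; rewrite E mulrSr addrAC subrr add0r mulr1.
Qed.

(** The increment is [b' c] with [n < c < n + 1], and [b'] loses only a small proportion of itself
    over a unit interval because [b''] is small against [b']. *)
Lemma Hardy_derive_ratio_cvg1 :
  derive1 b n%:R / (b n.+1%:R - b n%:R) @[n --> \oo] --> (1 : R).
Proof.
have Hb' := Hardy_derive HH Hb.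
apply/cvgrPdist_le => e e0; pose m := Num.truncn e^-1.
have me : 1 <= m.+1%:R * e by rewrite -ler_pdivrMr// div1r ltW// truncnS_gt.
have near_ge (P : R -> Prop) : (\forall x \near +oo, P x) ->
    \forall n \near \oo, forall x, (n : nat)%:R <= x -> P x.
  by move=> /near_pinfty_ge/cvgr_idn.
have bder := near_ge _ (Hardy_is_derive HH Hb).
have b'der := near_ge _ (Hardy_is_derive HH Hb').
have b'0 := near_ge _ (Hardy_derive_gt0 HH Hb boo).
(* With [m + 2], the mean value theorem gives [(m + 2) * (b' n - b' (n+1)) <= b' n], that is,
   [(m + 1) * (b' n - b' (n+1)) <= b' (n+1)]; and [1 / (m + 1) <= e]. *)
have small := near_ge _ (Hardy_derive2_small HH m.+2 Hb boo).
have mono := cvgr_idn (near_derive_le0 (Hardy_is_derive HH Hb')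
  (Hardy_derive2_le0 HH Hb boo bx0)).
near=> n.
have bdern : forall x : R, n%:R <= x -> is_derive (x : R) 1 b (derive1 b x) by near: n.
have b'dern : forall x : R, n%:R <= x ->
  is_derive (x : R) 1 (derive1 b) (derive1 (derive1 b) x) by near: n.
have b'0n : forall x : R, n%:R <= x -> 0 < derive1 b x by near: n.
have smalln : forall x : R, n%:R <= x ->
  0 <= m.+2%:R * derive1 (derive1 b) x + derive1 b x by near: n.
have monon : forall x y : R, n%:R <= x -> x <= y -> derive1 b y <= derive1 b x by near: n.
have [c [nc cn ->]] := MVT_nat bdern (lexx _).
have [t [nt tn E]] := MVT_nat b'dern (lexx _).
have c0 := b'0n _ (ltW nc).
have t1 : derive1 b t <= derive1 b n%:R by apply: monon => //; exact: ltW.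
have c1 : derive1 b n.+1%:R <= derive1 b c by apply: monon; exact: ltW.
have c2 : derive1 b c <= derive1 b n%:R by apply: monon => //; exact: ltW.
have := smalln _ (ltW nt); rewrite -E mulrSr => h.
rewrite distrC ger0_norm ?subr_ge0 ?ler_pdivlMr ?mul1r//.
rewrite lerBlDr ler_pdivrMr// mulrDl mul1r -lerBlDr.
have : derive1 b c <= m.+1%:R * e * derive1 b c by rewrite ler_peMl// ltW.
rewrite -mulrA => h2.
have m0 : 0 < m.+1%:R :> R by [].
rewrite -(ler_pM2l m0).
have : m.+1%:R * (derive1 b n%:R - derive1 b c) <=
    m.+1%:R * (derive1 b n%:R - derive1 b n.+1%:R).
  by rewrite ler_pM2l// lerD2l lerN2.
lra.
Unshelve. all: by end_near. Qed.

Section increments.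
Variable n0 : nat.
Hypothesis Wder : forall x : R, n0%:R <= x -> is_derive (x : R) 1 W (derive1 W x).
Hypothesis w_gt0 : forall x : R, n0%:R <= x -> 0 < derive1 W x.
Hypothesis w_mono : forall x y : R, n0%:R <= x -> x <= y -> derive1 W y <= derive1 W x.

Lemma increment_bounds n :
  derive1 W (n0 + n.+1)%:R <= W (n0 + n.+1)%:R - W (n0 + n)%:R <= derive1 W (n0 + n)%:R.
Proof.
have n0n : n0%:R <= (n0 + n)%:R :> R by rewrite ler_nat leq_addr.
rewrite addnS; have [c [nc cn ->]] := MVT_nat Wder n0n.
by rewrite !w_mono// ?(le_trans n0n)// ltW.
Qed.

Lemma sum_derive_bounds n :
  W (n0 + n)%:R - W n0%:R <= \sum_(0 <= i < n) derive1 W (n0 + i)%:R <=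
  derive1 W n0%:R + (W (n0 + n)%:R - W n0%:R).
Proof.
apply/andP; split.
  elim: n => [|n IH]; first by rewrite addn0 subrr big_geq.
  rewrite big_nat_recr//=; have /andP[_] := increment_bounds n; move: IH; lra.
apply: (@le_trans _ _ (\sum_(0 <= i < n.+1) derive1 W (n0 + i)%:R)).
  by rewrite big_nat_recr//= lerDl ltW// w_gt0// ler_nat leq_addr.
elim: n => [|n IH]; first by rewrite big_nat1 addn0 subrr addr0.
rewrite big_nat_recr//=; have /andP[+ _] := increment_bounds n; move: IH; lra.
Qed.

Lemma inv_shift_cvg0 : (W (n0 + n)%:R)^-1 @[n --> \oo] --> 0.
Proof.
have h := cvg_nat_shift_pinfty n0 Woo.
by apply/gtr0_cvgV0 => //; have /cvgryPgt/(_ 0) := h.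
Qed.

Lemma sum_derive_cvg1 : (\sum_(0 <= i < n) derive1 W (n0 + i)%:R) / W (n0 + n)%:R
  @[n --> \oo] --> (1 : R).
Proof.
pose c := W n0%:R; pose d := derive1 W n0%:R.
have Winv := inv_shift_cvg0.
apply: (@squeeze_cvgr _ _ _ _ (fun n => 1 - c * (W (n0 + n)%:R)^-1)
   (fun n => 1 + (d - c) * (W (n0 + n)%:R)^-1)).
- have /cvgryPgt/(_ 0) := cvg_nat_shift_pinfty n0 Woo.
  apply: filterS => n Wn; have /andP[h1 h2] := sum_derive_bounds n.
  have Wn' : W (n0 + n)%:R != 0 by rewrite gt_eqF.
  rewrite ler_pdivlMr// ler_pdivrMr// mulrBl mulrDl mul1r !divfK// h1/=.
  by rewrite (le_trans h2)// /c /d; lra.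
- rewrite -[X in _ --> X]subr0 -(mulr0 c).
  by apply: cvgB; [exact: cvg_cst|exact: cvgMr].
- rewrite -[X in _ --> X]addr0 -(mulr0 (d - c)).
  by apply: cvgD; [exact: cvg_cst|exact: cvgMr].
Qed.

(** The averages include the term of index [N], whereas the comparison of means divides a sum over
    [i < n] by the value of [W] at [n]; this ratio corrects the off-by-one. *)
Lemma ratio_shift_cvg1 : W (n0 + n.+1)%:R / W (n0 + n)%:R @[n --> \oo] --> (1 : R).
Proof.
have Winv := inv_shift_cvg0.
apply: (@squeeze_cvgr _ _ _ _ (cst 1)
   (fun n => 1 + derive1 W n0%:R * (W (n0 + n)%:R)^-1)).
- have /cvgryPgt/(_ 0) := cvg_nat_shift_pinfty n0 Woo.
  apply: filterS => n Wn; have /andP[h1 h2] := increment_bounds n.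
  have n0n : n0%:R <= (n0 + n)%:R :> R by rewrite ler_nat leq_addr.
  have n0n' : n0%:R <= (n0 + n.+1)%:R :> R by rewrite ler_nat leq_addr.
  rewrite /= ler_pdivlMr// mul1r ler_pdivrMr// mulrDl mul1r divfK ?gt_eqF//.
  by have := w_gt0 n0n'; have := w_mono (lexx _) n0n; lra.
- exact: cvg_cst.
- rewrite -[X in _ --> X]addr0 -(mulr0 (derive1 W n0%:R)).
  by apply: cvgD; [exact: cvg_cst|exact: cvgMr].
Qed.

End increments.

(** The weights and values are prescribed only for large [n], so that the result applies to [w] and
    to [|w|], and to orbits for which [floor (a n)] has its final sign only eventually. *)
Lemma Hardy_weighted_average (v G F : nat -> R) (L L' : R) :
  (\forall n \near \oo, v n = derive1 W n%:R) ->
  (\forall n \near \oo, G n = F (s n)) ->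
  (\sum_(0 <= m < n) F m) / n%:R @[n --> \oo] --> L ->
  (\sum_(0 <= m < n) `|F m|) / n%:R @[n --> \oo] --> L' ->
  (W N%:R)^-1 * \sum_(1 <= n < N.+1) v n * G n @[N --> \oo] --> L.
Proof.
move=> vE GE FL FL'.
have near_ge (P : R -> Prop) : (\forall x \near +oo, P x) ->
    \forall n \near \oo, forall x, (n : nat)%:R <= x -> P x.
  by move=> /near_pinfty_ge/cvgr_idn.
have Hb' := Hardy_derive HH Hb.
have bder := near_ge _ (Hardy_is_derive HH Hb).
have b'0 := near_ge _ (Hardy_derive_gt0 HH Hb boo).
have mono := cvgr_idn (near_derive_le0 (Hardy_is_derive HH Hb')
  (Hardy_derive2_le0 HH Hb boo bx0)).
have b'cvg0 := Hardy_derive_cvg0 HH Hb boo bx0.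
have /near_ge b'1 : \forall x \near +oo, `|derive1 b x| < 1.
  by move/cvgr0Pnorm_lt : b'cvg0; exact.
have /near_ge b1 : \forall x \near +oo, 1 <= b x by move/cvgryPge : boo; exact.
have /near_ge W1 : \forall x \near +oo, 1 <= W x by move/cvgryPge : Woo; exact.
have W0 : \forall x \near +oo, 0 < W x by move/cvgryPgt : Woo; exact.
have Wder := near_ge _ (Hardy_is_derive HH HW).
have w_gt0 := near_ge _ w0.
have w_mono := cvgr_idn w_nincr.
have growth := near_ge _ (Hardy_log_growth HH Hb HW boo W0 Wb).
pose ux x := derive1 W x / derive1 b x.
have umono : \forall n \near \oo,
    (forall x y : R, n%:R <= x -> x <= y -> ux x <= ux y) \/
    (forall x y : R, n%:R <= x -> x <= y -> ux y <= ux x).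
  have [h|h] := Hardy_quotient_monotone HH HW Hb (Hardy_derive_gt0 HH Hb boo).
    have h' : \forall n \near \oo, forall x y : R, n%:R <= x -> x <= y -> ux x <= ux y.
      exact: cvgr_idn h.
    by apply: filterS h' => n hn; left.
  have h' : \forall n \near \oo, forall x y : R, n%:R <= x -> x <= y -> ux y <= ux x.
    exact: cvgr_idn h.
  by apply: filterS h' => n hn; right.
have near_leq (P : nat -> Prop) : (\forall n \near \oo, P n) ->
    \forall n \near \oo, forall m, (n <= m)%N -> P m.
  by move=> [N _ NP]; exists N => // n Nn m nm; apply: NP; exact: leq_trans nm.
have sb_ge := near_leq _ sb; have vE_ge := near_leq _ vE; have GE_ge := near_leq _ GE.
(* All eventual properties hold together from [n0] on; shifting every sequence by [n0] makes them
   hold for all indices. *)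
near \oo => n0.
have n0_gt0 : (0 < n0)%N by near: n0; exists 1%N.
have fbder : forall x : R, n0%:R <= x -> is_derive (x : R) 1 b (derive1 b x) by near: n0.
have fb'0 : forall x : R, n0%:R <= x -> 0 < derive1 b x by near: n0.
have fmono : forall x y : R, n0%:R <= x -> x <= y -> derive1 b y <= derive1 b x by near: n0.
have fb'1 : forall x : R, n0%:R <= x -> `|derive1 b x| < 1 by near: n0.
have fb1 : forall x : R, n0%:R <= x -> 1 <= b x by near: n0.
have fW1 : forall x : R, n0%:R <= x -> 1 <= W x by near: n0.
have fWder : forall x : R, n0%:R <= x -> is_derive (x : R) 1 W (derive1 W x) by near: n0.
have fw_gt0 : forall x : R, n0%:R <= x -> 0 < derive1 W x by near: n0.
have fw_mono : forall x y : R, n0%:R <= x -> x <= y -> derive1 W y <= derive1 W x by near: n0.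
have fgrowth : forall x : R, n0%:R <= x ->
  derive1 W x * b x <= k.+1%:R * W x * derive1 b x by near: n0.
have fumono : (forall x y : R, n0%:R <= x -> x <= y -> ux x <= ux y) \/
    (forall x y : R, n0%:R <= x -> x <= y -> ux y <= ux x) by near: n0.
have fsb : forall m, (n0 <= m)%N -> (s m)%:R <= b m%:R <= (s m).+1%:R by near: n0.
have fvE : forall m, (n0 <= m)%N -> v m = derive1 W m%:R by near: n0.
have fGE : forall m, (n0 <= m)%N -> G m = F (s m) by near: n0.
have n0n n : n0%:R <= (n0 + n)%:R :> R by rewrite ler_nat leq_addr.
have incr n : exists c, [/\ (n0 + n)%:R < c, c < (n0 + n.+1)%:R &
    b (n0 + n.+1)%:R - b (n0 + n)%:R = derive1 b c].
  by rewrite addnS; exact: (MVT_nat fbder (n0n n)).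
have incr_gt0 n : 0 < b (n0 + n.+1)%:R - b (n0 + n)%:R.
  by have [c [nc _ ->]] := incr n; rewrite fb'0// (le_trans (n0n n))// ltW.
have incr_le n : b (n0 + n.+1)%:R - b (n0 + n)%:R <= derive1 b (n0 + n)%:R.
  by have [c [nc _ ->]] := incr n; rewrite fmono// ltW.
have b'cvg : derive1 b (n0 + n)%:R @[n --> \oo] --> 0 by exact: cvg_nat_shift_pinfty.
have core : (\sum_(0 <= i < n) derive1 W (n0 + i)%:R * F (s (n0 + i)%N)) / W (n0 + n)%:R
    @[n --> \oo] --> L.
  (* In the constant, [k + 1] comes from the bound on [W' b / b'], and [W' n0] from comparing the
     sum of the weights with the growth of [W]. *)
  apply: (@weighted_average_cvg _ L L' (fun n => b (n0 + n)%:R)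
    (fun n => s (n0 + n)%N) F (fun n => ux (n0 + n)%:R)
    (fun n => derive1 b (n0 + n)%:R / (b (n0 + n.+1)%:R - b (n0 + n)%:R))
    (fun n => derive1 W (n0 + n)%:R) (fun n => W (n0 + n)%:R)
    (k.+1%:R + derive1 W n0%:R)) => //.
  - by move=> n; exact: fb1.
  - by move=> n; rewrite -subr_gt0.
  - exact: cvg_nat_shift_pinfty.
  - move=> n; rewrite (le_lt_trans (incr_le n))// (le_lt_trans (ler_norm _))//.
    exact: fb'1.
  - apply: (@squeeze_cvgr _ _ _ _ (cst 0) (fun n => derive1 b (n0 + n)%:R)) => //.
    + by apply: nearW => n; rewrite incr_le ltW.
    + exact: cvg_cst.
  - by move=> n; apply: fsb; rewrite leq_addr.
  - by move=> n; rewrite divr_ge0// ltW// ?fw_gt0 ?fb'0.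
  - case: fumono => h; [left|right] => n; apply: h => //;
      by rewrite ler_nat leq_add2l.
  - by move=> n; exact: fW1.
  - exact: cvg_nat_shift_pinfty.
  - move=> n; rewrite /ux mulrAC ler_pdivrMr ?fb'0// (le_trans (fgrowth _ (n0n n)))//.
    rewrite ler_pM2r ?fb'0// ler_pM2r ?lerDl ?ltW ?fw_gt0//.
    by rewrite (lt_le_trans _ (fW1 _ (n0n n))).
  - move=> n; have := sum_derive_bounds fWder fw_gt0 fw_mono n.
    move=> /andP[_ hS].
    have : \sum_(0 <= i < n) ux (n0 + i)%:R * (b (n0 + i.+1)%:R - b (n0 + i)%:R) <=
        \sum_(0 <= i < n) derive1 W (n0 + i)%:R.
      apply: ler_sum => i _; rewrite /ux mulrAC ler_pdivrMr ?fb'0//.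
      by rewrite ler_pM2l ?fw_gt0.
    move/le_trans; apply; apply: (le_trans hS).
    have W1n := fW1 _ (n0n n); have W10 := fW1 _ (lexx n0%:R).
    have d0 := fw_gt0 _ (lexx n0%:R).
    have : derive1 W n0%:R <= derive1 W n0%:R * W (n0 + n)%:R by rewrite ler_peMr// ltW.
    have : W (n0 + n)%:R <= k.+1%:R * W (n0 + n)%:R.
      by rewrite ler_peMl// ?ler1n// (le_trans _ W1n).
    by rewrite mulrDl; lra.
  - move=> n; rewrite /ux.
    have h1 := gt_eqF (incr_gt0 n); have h2 := gt_eqF (fb'0 _ (n0n n)).
    by field; rewrite h1 h2.
  - under eq_fun do rewrite addnS.
    exact: (@cvg_comp _ _ _ (addn n0) _ _ _ _ (cvg_addnl n0)
      Hardy_derive_ratio_cvg1).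
  - exact: sum_derive_cvg1.
have ratio := ratio_shift_cvg1 fWder fw_gt0 fw_mono.
have Winv := inv_shift_cvg0 n0.
(* The terms before [n0] form a constant, removed by [W --> +oo]. *)
pose C := \sum_(1 <= n < n0) v n * G n.
have h1 : C * (W (n0 + n)%:R)^-1 @[n --> \oo] --> C * 0 by exact: cvgMr.
have h2 : (\sum_(0 <= i < n.+1) derive1 W (n0 + i)%:R * F (s (n0 + i)%N)) / W (n0 + n.+1)%:R
    @[n --> \oo] --> L by move: core; rewrite -cvg_shiftS.
have := cvgD h1 (cvgM h2 ratio); rewrite mulr0 add0r mulr1 => h3.
pose u N := (W N%:R)^-1 * \sum_(1 <= n < N.+1) v n * G n.
suff : u (n + n0)%N @[n --> \oo] --> L by rewrite (cvg_shiftn n0 u).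
suff -> : (fun n => u (n + n0)%N) = (fun n => C * (W (n0 + n)%:R)^-1 +
    (\sum_(0 <= i < n.+1) derive1 W (n0 + i)%:R * F (s (n0 + i)%N)) /
    W (n0 + n.+1)%:R * (W (n0 + n.+1)%:R / W (n0 + n)%:R)) by exact: h3.
apply/funext => n; rewrite /u addnC.
have Wn0 : W (n0 + n.+1)%:R != 0 by rewrite gt_eqF// (lt_le_trans _ (fW1 _ (n0n _))).
rewrite [_ / _ * (_ / _)]mulrA divfK// -mulrDl mulrC; congr (_ / _).
rewrite (big_cat_nat (n := n0))//=; last by rewrite -addnS leq_addr.
congr (_ + _); rewrite -{1}[n0]add0n -addnS [(n0 + n.+1)%N]addnC big_addn addnK.
rewrite !big_nat; apply: eq_bigr => i _.
by rewrite addnC fvE ?fGE ?leq_addr.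
Unshelve. all: by end_near. Qed.

End Hardy_average.

(** * Averages along [floor (a n)] *)

Section orbits.
Context {R : realType} {d : measure_display} {X : measurableType d}.
Context {mu : probability X R} (T : invertible_mpt mu).

Lemma mpt_inv_preserving A : measurable A -> mu (mpt_inv T @^-1` A) = mu A.
Proof.
move=> mA; rewrite -[LHS](mpt_preserving T).
  by congr (mu _); apply/seteqP; split=> x /=; rewrite mpt_funK.
by rewrite -[X in measurable X]setTI; exact: mpt_measurable_inv.
Qed.

Lemma integrable_mpt_iter_int k (f : X -> R) : mu.-integrable setT (EFin \o f) ->
  mu.-integrable setT (EFin \o (fun x => f (mpt_iter T k x))).
Proof.
move=> fi; case: k => n.
  exact: (integrable_mpt_iter (mpt_measurable_fun T) (mpt_preserving T) n fi).
exact: (integrable_mpt_iter (mpt_measurable_inv T) mpt_inv_preserving n.+1 fi).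
Qed.

Lemma Rintegral_mpt_iter_int k (f : X -> R) : mu.-integrable setT (EFin \o f) ->
  \int[mu]_x f (mpt_iter T k x) = \int[mu]_x f x.
Proof.
move=> fi; case: k => n.
  exact: (Rintegral_mpt_iter (mpt_measurable_fun T) (mpt_preserving T) n fi).
exact: (Rintegral_mpt_iter (mpt_measurable_inv T) mpt_inv_preserving n.+1 fi).
Qed.

(** As [Negz m] is [- (m + 1)], the backward orbit starts at [mpt_inv T x]; Birkhoff's theorem is
    accordingly applied to [f \o mpt_inv T]. *)
Definition signed_orbit (sg : bool) (m : nat) : X -> X :=
  mpt_iter T (if sg then Posz m else Negz m).

Lemma signed_orbit_cvg_ae sg (f : X -> R) : mu.-integrable setT (EFin \o f) ->
  {ae mu, forall x, cvgn (fun n => (\sum_(0 <= m < n) f (signed_orbit sg m x)) / n%:R)}.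
Proof.
move=> fi; case: sg.
  exact: (birkhoff_cvg_ae (mpt_measurable_fun T) (mpt_preserving T) fi).
have fi' := integrable_mpt (mpt_measurable_inv T) mpt_inv_preserving fi.
exact: (birkhoff_cvg_ae (mpt_measurable_inv T) mpt_inv_preserving fi').
Qed.

Lemma signed_orbit_cvg_ergodic sg (f : X -> R) : ergodic_mpt T ->
  mu.-integrable setT (EFin \o f) ->
  {ae mu, forall x, (\sum_(0 <= m < n) f (signed_orbit sg m x)) / n%:R
    @[n --> \oo] --> \int[mu]_x f x}.
Proof.
move=> erg fi; case: sg.
  exact: (birkhoff_cvg_ergodic (mpt_measurable_fun T) (mpt_preserving T) fi erg).
have fi' := integrable_mpt (mpt_measurable_inv T) mpt_inv_preserving fi.
rewrite -(Rintegral_mpt (mpt_measurable_inv T) mpt_inv_preserving fi).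
have erg' A : measurable A -> mpt_inv T @^-1` A = A -> mu A = 0%E \/ mu A = 1%E.
  move=> mA iA; apply: erg => //; rewrite -{1}iA.
  by apply/seteqP; split=> x /=; rewrite mpt_funK.
exact: (birkhoff_cvg_ergodic (mpt_measurable_inv T) mpt_inv_preserving fi' erg').
Qed.

End orbits.

Section weighted_sums.
Context {R : realType} {d : measure_display} {X : measurableType d}.
Context {mu : probability X R} (T : invertible_mpt mu) (s : nat -> int).
Variables (v : nat -> R) (f : X -> R) (N : nat).
Hypothesis fi : mu.-integrable setT (EFin \o f).

Lemma integrable_weighted_sum : mu.-integrable setT
  (EFin \o (fun x => \sum_(1 <= n < N) v n * f (mpt_iter T (s n) x))).
Proof.
have -> : EFin \o (fun x => \sum_(1 <= n < N) v n * f (mpt_iter T (s n) x)) =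
  (fun x => \sum_(1 <= n < N) ((v n)%:E * (f (mpt_iter T (s n) x))%:E))%E.
  by apply/funext => x /=; rewrite -sumEFin.
apply: (integrable_sum measurableT) => n _; apply: (integrableZl measurableT).
exact: integrable_mpt_iter_int.
Qed.

Lemma Rintegral_weighted_sum :
  \int[mu]_x (\sum_(1 <= n < N) v n * f (mpt_iter T (s n) x)) =
  (\sum_(1 <= n < N) v n) * \int[mu]_x f x.
Proof.
rewrite /Rintegral; under eq_integral do rewrite -sumEFin.
rewrite integral_sum//; last first.
  by move=> n; apply: (integrableZl measurableT (v n) (integrable_mpt_iter_int T (s n) fi)).
have fin : (\int[mu]_x (f x)%:E)%E \is a fin_num by exact: integrable_fin_num.
rewrite -[RHS]/(fine ((\sum_(1 <= n < N) v n) * fine (\int[mu]_x (f x)%:E)%E)%:E).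
congr fine; rewrite mulr_suml -sumEFin; apply: eq_bigr => n _.
rewrite (integralZl _ (integrable_mpt_iter_int T (s n) fi))//.
rewrite EFinM; congr (_ * _)%E.
have := Rintegral_mpt_iter_int T (s n) fi; rewrite /Rintegral => <-.
by rewrite fineK//; exact: (integrable_fin_num _ (integrable_mpt_iter_int T (s n) fi)).
Qed.

End weighted_sums.

Section floor_level.
Context {R : realType}.

(* The [m] such that [floor x] is [m] if [x >= 0] and [- (m + 1)] if [x < 0]. *)
Definition floor_level (x : R) : nat :=
  match Num.floor x with Posz m => m | Negz m => m end.

Lemma floor_level_pos (x : R) : 0 < x ->
  Num.floor x = Posz (floor_level x) /\
  (floor_level x)%:R <= x <= (floor_level x).+1%:R.
Proof.
move=> x0; rewrite /floor_level; have /andP[h1 h2] := floor_itv x.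
have : 0 <= Num.floor x by rewrite floor_ge0 ltW.
case: (Num.floor x) h1 h2 => // m h1 h2 _; split => //.
by rewrite h1/= (le_trans (ltW h2))// rmorphD/= mulrSr.
Qed.

(** The upper bound is attained at negative integers, hence the non-strict inequality. *)
Lemma floor_level_neg (x : R) : x < 0 ->
  Num.floor x = Negz (floor_level x) /\
  (floor_level x)%:R <= - x <= (floor_level x).+1%:R.
Proof.
move=> x0; rewrite /floor_level; have /andP[h1 h2] := floor_itv x.
have : Num.floor x < 0 by rewrite floor_lt0.
case: (Num.floor x) h1 h2 => // m; rewrite NegzE => h1 h2 _; split => //.
move: h1 h2; rewrite rmorphD !rmorphN/= -!pmulrn mulrSr; lra.
Qed.

End floor_level.

Section floor_average.
Context {R : realType} (a W : R -> R).
Hypothesis aU : Hardy_U a.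
Hypothesis a_infty : `|a x| @[x --> +oo] --> +oo.
Hypothesis a_sublinear : a x / x @[x --> +oo] --> 0.
Hypothesis WE : Hardy_E W.
Hypothesis w_gt0 : \forall x \near +oo, 0 < derive1 W x.
Hypothesis w_nincr : \forall M \near +oo,
     forall x y : R, M <= x -> x <= y -> derive1 W y <= derive1 W x.
Hypothesis W_infty : W x @[x --> +oo] --> +oo.
Hypothesis W_le : exists2 c : R, 0 < c & \forall x \near +oo, W x <= `|a x| `^ c.

(** The growth estimate differentiates natural powers; enlarging the exponent is harmless once
    [|a x| >= 1]. *)
Lemma W_le_exprn : exists k, \forall x \near +oo, W x <= `|a x| ^+ k.
Proof.
have [c c0 Wc] := W_le; exists (Num.truncn c).+1.
have /cvgryPge/(_ 1) := a_infty; move: Wc; apply: filterS2 => x Wx a1.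
rewrite (le_trans Wx)// -powR_mulrn; last by rewrite (le_trans _ a1).
by apply: ler_powR => //; rewrite ltW// truncnS_gt.
Qed.

(** The eventual sign of [a] selects the direction of the orbit. It is chosen before the data [v],
    [G], [F], so that a single direction serves almost every point. *)
Lemma floor_weighted_average : exists sg : bool,
  (\forall n \near \oo, Num.floor (a n%:R) =
     if sg then Posz (floor_level (a n%:R)) else Negz (floor_level (a n%:R))) /\
  forall (v G F : nat -> R) (L L' : R),
  (\forall n \near \oo, v n = derive1 W n%:R) ->
  (\forall n \near \oo, G n = F (floor_level (a n%:R))) ->
  (\sum_(0 <= m < n) F m) / n%:R @[n --> \oo] --> L ->
  (\sum_(0 <= m < n) `|F m|) / n%:R @[n --> \oo] --> L' ->
  (W N%:R)^-1 * \sum_(1 <= n < N.+1) v n * G n @[N --> \oo] --> L.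
Proof.
have [H0 H0H H0a] := aU; have [H [HH maxH] H0sub] := maximal_Hardy_field_ext H0H.
have Ha : H a by exact: H0sub.
have HW : H W by apply: WE; split.
have [k Wk] := W_le_exprn.
have [h|h|h] := Hardy_sign HH Ha.
- exfalso; apply: (cvg_pinfty_unbounded (C := 0) a_infty).
  by apply: filterS h => x ->; rewrite normr0.
- have hn : \forall n \near \oo, 0 < a (n : nat)%:R by exact: cvgr_idn h.
  exists true; split; first by apply: filterS hn => n /floor_level_pos[].
  move=> v G F L L'; apply: (@Hardy_weighted_average _ H HH a W k) => //.
  + apply: cvg_trans a_infty; apply: near_eq_cvg.
    by apply: filterS h => x ax; rewrite gtr0_norm.
  + by move: h Wk; apply: filterS2 => x ax; rewrite gtr0_norm.
  + by apply: filterS hn => n /floor_level_pos[].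
- have hn : \forall n \near \oo, a (n : nat)%:R < 0 by exact: cvgr_idn h.
  exists false; split; first by apply: filterS hn => n /floor_level_neg[].
  move=> v G F L L'; apply: (@Hardy_weighted_average _ H HH (\- a) W k) => //.
  + exact: Hardy_opp.
  + apply: cvg_trans a_infty; apply: near_eq_cvg.
    by apply: filterS h => x ax; rewrite ltr0_norm.
  + rewrite -oppr0; under eq_fun do rewrite /= mulNr.
    exact: cvgN.
  + by move: h Wk; apply: filterS2 => x ax; rewrite ltr0_norm.
  + by apply: filterS hn => n /floor_level_neg[].
Qed.

Let s n : int := Num.floor (a n%:R).

Lemma pointwise_good1 : pointwise_good 1%E W s.
Proof.
move=> d X mu T f /Lfun1_integrable fi.
have [sg [aE avg]] := floor_weighted_average.
have fabs : mu.-integrable setT (EFin \o (fun x => `|f x|)).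
  exact: (integrable_abse fi).
move: (signed_orbit_cvg_ae T sg fi) (signed_orbit_cvg_ae T sg fabs).
apply: filterS2 => x /cvg_ex[L fL] /cvg_ex[L' fL'].
apply/cvg_ex; exists L; apply: (avg _ _ _ _ _ _ _ fL fL'); first exact: nearW.
by apply: filterS aE => n aE; rewrite /s aE /signed_orbit; case: (sg).
Qed.

Lemma ergodic_average_cvg_ae d (X : measurableType d) (mu : probability X R)
    (T : invertible_mpt mu) (v : nat -> R) (f : X -> R) :
  ergodic_mpt T ->
  (\forall n \near \oo, v n = derive1 W n%:R) ->
  mu.-integrable setT (EFin \o f) ->
  {ae mu, forall x, (W N%:R)^-1 * \sum_(1 <= n < N.+1) v n * f (mpt_iter T (s n) x)
     @[N --> \oo] --> \int[mu]_x f x}.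
Proof.
move=> erg vE fi; have [sg [aE avg]] := floor_weighted_average.
have fabs : mu.-integrable setT (EFin \o (fun x => `|f x|)).
  exact: (integrable_abse fi).
move: (signed_orbit_cvg_ergodic sg erg fi) (signed_orbit_cvg_ergodic sg erg fabs).
apply: filterS2 => x fL fL'; apply: (avg _ _ _ _ _ vE _ fL fL').
by apply: filterS aE => n aE; rewrite /s aE /signed_orbit; case: (sg).
Qed.

(** This is the averaging result for the constant sequence [1]. *)
Lemma weight_sum_cvg1 (v : nat -> R) :
  (\forall n \near \oo, v n = derive1 W n%:R) ->
  (W N%:R)^-1 * \sum_(1 <= n < N.+1) v n @[N --> \oo] --> (1 : R).
Proof.
move=> vE; have [sg [aE avg]] := floor_weighted_average.
have one : (\sum_(0 <= m < n) (1 : R)) / n%:R @[n --> \oo] --> (1 : R).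
  apply: cvg_near_cst; exists 1%N => // n /= n0.
  by rewrite sumr_const_nat subn0 divff// pnatr_eq0 -lt0n.
have one' : (\sum_(0 <= m < n) `|1 : R|) / n%:R @[n --> \oo] --> (1 : R).
  by rewrite normr1.
have h : \forall n \near \oo, (cst 1 : nat -> R) n = cst 1 (floor_level (a n%:R)).
  exact: nearW.
have := avg v (cst 1) (cst 1) 1 1 vE h one one'.
suff -> : (fun N => (W N%:R)^-1 * \sum_(1 <= n < N.+1) v n * cst 1 n) =
  (fun N => (W N%:R)^-1 * \sum_(1 <= n < N.+1) v n) by [].
by apply/funext => N; congr (_ * _); apply: eq_bigr => n _; rewrite mulr1.
Qed.

(* By Cauchy-Schwarz, [(A_N f)^2] is at most a bounded multiple of [A_N (f^2)],
   whose integrals converge to that of its almost everywhere limit. *)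
Lemma ergodic_for_W_averages :
  ergodic_for_averages W (fun n => Num.floor (a n%:R)).
Proof.
move=> d X mu T f erg fL2; rewrite -/s.
have f2i : mu.-integrable setT (EFin \o (fun x => f x ^+ 2)).
  exact: Lfun2_integrable_sqr.
have fi : mu.-integrable setT (EFin \o f).
  by apply/Lfun1_integrable; apply: Lfun_subset12 fL2; exact: fin_num_measure.
set c := \int[mu]_x f x; pose c2 := \int[mu]_x f x ^+ 2.
pose w n := derive1 W n%:R; pose A N x := W_average W s T f N x - c.
pose q N := (W N%:R)^-1 * \sum_(1 <= n < N.+1) `|w n|.
pose Q N x := (W N%:R)^-1 * \sum_(1 <= n < N.+1) `|w n| * f (mpt_iter T (s n) x) ^+ 2.
(* This majorant comes from [(S - c) ^+ 2 <= 2 * S ^+ 2 + 2 * c ^+ 2] and the Cauchy-Schwarz bound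
   [S ^+ 2 <= q N * Q N x]. *)
pose g N x := 2 * q N * Q N x + 2 * c ^+ 2.
have abs_w : \forall n \near \oo, `|w n| = w n.
  have : \forall n \near \oo, 0 < w n by exact: cvgr_idn w_gt0.
  by apply: filterS => n wn; rewrite gtr0_norm.
have qcvg : q N @[N --> \oo] --> (1 : R).
  exact: weight_sum_cvg1.
have Qi N : mu.-integrable setT (EFin \o Q N).
  have -> : EFin \o Q N = (fun x => ((W N%:R)^-1)%:E *
     (EFin \o (fun x => \sum_(1 <= n < N.+1) `|w n| * f (mpt_iter T (s n) x) ^+ 2)%R) x)%E.
    by apply/funext => x /=; rewrite -EFinM.
  apply: integrableZl => //.
  exact: (integrable_weighted_sum T s (fun n => `|w n|) N.+1 f2i).
have QE N : \int[mu]_x Q N x = q N * c2.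
  rewrite /Q RintegralZl//; last first.
    exact: (integrable_weighted_sum T s (fun n => `|w n|) N.+1 f2i).
  by rewrite (Rintegral_weighted_sum T s (fun n => `|w n|) N.+1 f2i) mulrA.
have gi N : mu.-integrable setT (EFin \o g N).
  have -> : EFin \o g N = ((fun x => (2 * q N)%:E * (EFin \o Q N) x) \+
      (EFin \o cst (2 * c ^+ 2)%R))%E.
    by apply/funext => x /=; rewrite -EFinM -EFinD.
  apply: integrableD => //; first exact: integrableZl.
  exact: finite_measure_integrable_cst.
have gE N : \int[mu]_x g N x = 2 * q N * (q N * c2) + 2 * c ^+ 2.
  rewrite /g RintegralD//.
  - rewrite RintegralZl// QE; congr (_ + _); rewrite Rintegral_cst//.
    by rewrite [X in fine X](_ : _ = 1%E) ?mulr1//; exact: probability_setT.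
  - have -> : EFin \o (fun x => 2 * q N * Q N x) =
      (fun x => (2 * q N)%:E * (EFin \o Q N) x)%E by [].
    exact: integrableZl.
  - exact: finite_measure_integrable_cst.
have mA N : measurable_fun setT (A N).
  apply: measurable_funB => //; apply: measurable_funM => //.
  apply/measurable_EFinP.
  exact: measurable_int (integrable_weighted_sum T s w N.+1 fi).
have Ag N x : A N x ^+ 2 <= g N x.
  set S := W_average W s T f N x.
  have S2 : S ^+ 2 <= q N * Q N x.
    rewrite /S /W_average /q /Q exprMn [leRHS]mulrACA -[X in _ <= X * _]expr2 ler_wpM2l ?sqr_ge0//.
    exact: weighted_cauchy_schwarz.
  have := sqr_ge0 (S + c); rewrite /A /g -/S !expr2 in S2 *; nra.
have A2i N : mu.-integrable setT (EFin \o (fun x => A N x ^+ 2)).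
  apply: (le_integrable _ _ _ (gi N)) => //.
    by apply/measurable_EFinP; exact: measurable_funX.
  move=> x _; rewrite /= lee_fin ger0_norm ?sqr_ge0//.
  by rewrite (le_trans (Ag N x))// ler_norm.
(* Since [q] tends to [1] and [Q] to [c2] almost everywhere, [g] tends to [2 * c2 + 2 * c ^+ 2]; its
   integrals have the same limit because [T] preserves the integral of [f ^+ 2]. *)
have h : \int[mu]_x A n x ^+ 2 @[n --> \oo] --> 0.
  apply: (@cvg_Rintegral_dominated_cvg _ _ _ mu (fun n x => A n x ^+ 2)
    g (2 * 1 * (1 * c2) + 2 * c ^+ 2)) => //.
  - by move=> n x; exact: sqr_ge0.
  - have wE : \forall n \near \oo, w n = derive1 W n%:R by exact: nearW.
    have := ergodic_average_cvg_ae erg wE fi.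
    apply: filterS => x Sx.
    have Ax : A N x @[N --> \oo] --> 0.
      by rewrite -(subrr c); apply: cvgB; [exact: Sx|exact: cvg_cst].
    by have := cvgM Ax Ax; rewrite mulr0; exact.
  - have := ergodic_average_cvg_ae erg abs_w f2i.
    apply: filterS => x Qx; rewrite mul1r; apply: cvgD; last exact: cvg_cst.
    by apply: cvgM; [apply: cvgM => //; exact: cvg_cst|exact: Qx].
  - rewrite (_ : (fun n => _) = (fun n => 2 * q n * (q n * c2) + 2 * c ^+ 2)).
      apply: cvgD; last exact: cvg_cst.
      by apply: cvgM; apply: cvgM => //; exact: cvg_cst.
    by apply/funext => n.
have hs : Num.sqrt (\int[mu]_x A n x ^+ 2) @[n --> \oo] --> 0.
  by have := cvg_comp _ _ h (@sqrt_continuous R 0); rewrite sqrtr0; exact.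
rewrite (_ : (fun N => _) = (fun N => (Num.sqrt (\int[mu]_x A N x ^+ 2))%:E)).
  exact: (cvg_comp _ _ hs).
by apply/funext => N; rewrite Lnorm2_Rintegral//; exact: A2i.
Qed.

End floor_average.

Theorem theorem1p3 (R : realType) (a W : R -> R)
  (aU : Hardy_U a)
  (a_infty : `|a x| @[x --> +oo] --> +oo)
  (a_sublinear : a x / x @[x --> +oo] --> 0)
  (WE : Hardy_E W)
  (w_gt0 : \forall x \near +oo, 0 < derive1 W x)
  (w_nincr : \forall M \near +oo,
     forall x y : R, M <= x -> x <= y -> derive1 W y <= derive1 W x)
  (W_infty : W x @[x --> +oo] --> +oo)
  (W_le : exists2 c : R, 0 < c & \forall x \near +oo, W x <= `|a x| `^ c) :
  pointwise_good 1%E W (fun n => Num.floor (a n%:R)) /\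
  ergodic_for_averages W (fun n => Num.floor (a n%:R)).
Proof.
by split; [exact: pointwise_good1|exact: ergodic_for_W_averages].
Qed.
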